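(* Let $D$ be a diagram of an oriented virtual knot $K$. Then for any $n\in\mathbb{N}$ the polynomial $$L^{n}_{D}(t,\ell)=\sum_{c\in C(D)}\operatorname{sgn}(c)\left(t^{\operatorname{Ind}(c)}\,\ell^{|\nabla J_n(D_c)|}-\ell^{|\nabla J_n(D)|}\right)$$ is an invariant of $K$; that is, if $D$ and $D'$ are two diagrams of the same oriented virtual knot, then $L^n_D(t,\ell)=L^n_{D'}(t,\ell)$.
   Context: $\mathbb{N}$ denotes the positive integers. A virtual knot diagram is a one-component planar knot diagram whose double points are either classical crossings (with over/under information) or virtual crossings. An oriented virtual knot is an equivalence class of oriented virtual knot diagrams under planar isotopy, the classical Reidemeister moves RI, RII, RIII, the virtual Reidemeister moves VRI, VRII, VRIII (the same moves with all crossings virtual), and the semi-virtual move SV (an arc with two consecutive virtual crossings is moved past a classical crossing). $C(D)$ is the set of classical crossings of $D$. Sign: draw a classical crossing $c$ with both strands oriented upward. Then $\operatorname{sgn}(c)=+1$ if the over-strand goes from bottom left to top right, and $\operatorname{sgn}(c)=-1$ if the over-strand goes from bottom right to top left. Index: an arc is an edge of $D$ between two consecutive classical crossings along the orientation. Label all arcs by integers so that labels are unchanged at virtual crossings and, at each classical crossing drawn with both strands oriented upward (whatever its sign), if the incoming arc on the left (bottom left) has label $a$ and the incoming arc on the right (bottom right) has label $b$, then the outgoing arc at top left has label $b+1$ and the outgoing arc at top right has label $a-1$. Such a labeling always exists: for example, label an arc $\alpha$ by $\lambda(\alpha)=\sum_{c\in O(\alpha)}\operatorname{sgn}(c)$,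 where $O(\alpha)$ is the set of classical crossings first met as overcrossings when traveling along the orientation starting from $\alpha$. Then $\operatorname{Ind}(c)=\operatorname{sgn}(c)(a-b-1)$. Dwrithe: for $n\in\mathbb{Z}\setminus\{0\}$, the $n$-th writhe is $J_n(D)=\sum_{c\in C(D),\,\operatorname{Ind}(c)=n}\operatorname{sgn}(c)$. For $n\in\mathbb{N}$ the $n$-th dwrithe is $\nabla J_n(D)=J_n(D)-J_{-n}(D)$. Smoothing against orientation: for $c\in C(D)$, $D_c$ is the oriented virtual knot diagram obtained by deleting $c$ and reconnecting so that (with both strands at $c$ oriented upward) the two top ends are joined to each other and the two bottom ends are joined to each other. The result is a one-component diagram, oriented as follows: the path of $D$ that leaves $c$ along the over-strand and returns to $c$ along the under-strand keeps its orientation, and the path that leaves $c$ along the under-strand and returns along the over-strand has its orientation reversed. *)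

(* Defs.v *)
From Stdlib Require Export Relation_Operators.
From HB Require Import structures.
From mathcomp Require Export all_boot all_order all_algebra.

Set Implicit Arguments.
Unset Strict Implicit.
Unset Printing Implicit Defensive.

Import Order.TTheory GRing.Theory Num.Theory.

(* An oriented one-component diagram, with its classical and its virtual      *)
(* double points, is a 4-regular plane map.  It is recorded by travelling     *)
(* once along the orientation, from a base point that is not a double point,  *)
(* and listing the passages through double points.  A passage records the     *)
(* name of the double point, whether the strand is the over-strand or the     *)
(* under-strand or the double point is virtual, and the position of the       *)
(* strand when both strands are drawn oriented upward: [lr v] holds if the    *)
(* strand goes from bottom left to top right, and fails if it goes from       *)
(* bottom right to top left.  The empty word is a circle without crossings.   *)

Inductive strand := Over | Under | Virtual.

Definition strand_code (k : strand) : option bool :=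
  match k with Over => Some true | Under => Some false | Virtual => None end.
Definition strand_decode (o : option bool) : strand :=
  match o with Some true => Over | Some false => Under | None => Virtual end.
Lemma strand_codeK : cancel strand_code strand_decode. Proof. by case. Qed.
HB.instance Definition _ := Equality.copy strand (can_type strand_codeK).

Record passage := Passage { name : nat; kind : strand; lr : bool }.

Definition passage_code (v : passage) := (name v, kind v, lr v).
Definition passage_decode (p : nat * strand * bool) :=
  Passage p.1.1 p.1.2 p.2.
Lemma passage_codeK : cancel passage_code passage_decode. Proof. by case. Qed.
HB.instance Definition _ := Equality.copy passage (can_type passage_codeK).

Definition opp_strand (k : strand) : strand :=
  match k with Over => Under | Under => Over | Virtual => Virtual end.

(* The other passage through the same double point. *)
Definition mate (v : passage) : passage :=
  Passage (name v) (opp_strand (kind v)) (~~ lr v).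

(* Every double point is passed exactly twice, by two matching passages. *)
Definition matched (w : seq passage) : bool :=
  uniq w && all (fun v => (mate v \in w) &&
                          (count (fun u => name u == name v) w == 2)) w.

(* Edge [i] of the map goes from passage [i] to passage [i + 1] (cyclically). *)
(* The dart [(i, true)] is edge [i] together with the region on its left, and *)
(* [(i, false)] is edge [i] together with the region on its right.  [turn]    *)
(* follows the boundary of a region, keeping it on the left-hand side: darts  *)
(* [(i, true)] are travelled along the orientation, darts [(i, false)]        *)
(* against it, and at a double point one takes the sharpest left turn.        *)
Definition mate_index (w : seq passage) (i : 'I_(size w)) : 'I_(size w) :=
  let v := tnth (in_tuple w) i in insubd i (index (mate v) w).

Definition turn (w : seq passage) (d : 'I_(size w) * bool) :
    'I_(size w) * bool :=
  let i := if d.2 then ordS d.1 else d.1 in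
  let m := mate_index i in
  if lr (tnth (in_tuple w) i) == d.2 then (m, true) else (ord_pred m, false).

(* Genus 0 by Euler's formula, (size w)/2 - size w + #regions = 2.  The       *)
(* crossingless circle is planar although it has no darts.                    *)
Definition planar (w : seq passage) : bool :=
  (w == [::]) || (fcard (@turn w) predT == (size w)./2 + 2)%N.

(* A map on the sphere becomes a map in the plane once the unbounded region   *)
(* is chosen.  The base point always lies on the boundary of this region:     *)
(* [out] holds if the unbounded region is on the left of the base point.  The *)
(* base point lies before the first passage, hence on the last edge.          *)
Record code := Code { out : bool; word : seq passage }.

Record diagram := Diagram {
  diagram_code :> code;
  diagram_matched : matched (word diagram_code);
  diagram_planar : planar (word diagram_code)
}.

(* The base point never lies on an edge that the disc of a move contains, so  *)
(* the unbounded region is unaffected by the move.  Conversely, by [ISObase], *)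
(* the base point can always be taken off these edges.  Moves are only used   *)
(* below between two codes that are both planar diagrams, so that names of    *)
(* new crossings are fresh and RII applies to two edges of the same region.   *)

Definition rename (f : nat -> nat) (v : passage) : passage :=
  Passage (f (name v)) (kind v) (lr v).

Definition classical (v : passage) : bool := kind v != Virtual.
Definition virtual (v : passage) : bool := kind v == Virtual.
Definition over (v : passage) : bool := kind v == Over.

Definition two (o : bool) (u v : passage) : seq passage :=
  if o then [:: u; v] else [:: v; u].

(* Three strands, numbered in the order in which they are met from the base   *)
(* point, cross pairwise: the first strand meets the second at [a], the first *)
(* meets the third at [b], the second meets the third at [c], where [a], [b]  *)
(* and [c] are the passages on the strand of lower number.  The first strand  *)
(* meets [a] before [b] iff [o1], the second meets [mate a] before [c] iff    *)
(* [o2], and the third meets [mate b] before [mate c] iff [o3].  Seen from a  *)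
(* strand that crosses another one at [v], the triangle lies on the left iff  *)
(* [lr v] and "the other strand meets this crossing first" are both true or   *)
(* both false.  The three edges bound a triangular region iff the two         *)
(* crossings of each strand give the same side for the triangle.              *)
Definition triangle (a b c : passage) (o1 o2 o3 : bool) : bool :=
  [&& (lr a == o2) == (lr b == o3),
      (lr (mate a) == o1) == (lr c == ~~ o3) &
      (lr (mate b) == ~~ o1) == (lr (mate c) == ~~ o2)].

Definition RIII_type (a b c : passage) : bool :=
  [&& classical a, classical b & classical c] &&
  [|| over a && over b, over (mate a) && over c
    | over (mate b) && over (mate c)].

Definition VRIII_type (a b c : passage) : bool :=
  [&& virtual a, virtual b & virtual c].

Definition SV_type (a b c : passage) : bool :=
  [|| [&& virtual a, virtual b & classical c],
      [&& virtual a, virtual c & classical b] |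
      [&& virtual b, virtual c & classical a]].

(* In RI a monogon is created; in RII a bigon.  For RII, [x] and [y] lie on   *)
(* one strand, and the two new edges bound a bigon iff [lr x] and [lr y]      *)
(* differ, whether the second strand runs parallel ([o]) or antiparallel.     *)
Inductive step : code -> code -> Prop :=
  | ISOname (f : nat -> nat) s w : injective f ->
      step (Code s w) (Code s (map (rename f) w))
  | ISObase s s' w (i j : 'I_(size w)) :
      fconnect (@turn w) (ord_pred i, s) (ord_pred j, s') ->
      step (Code s (rot i w)) (Code s' (rot j w))
  | RI s w1 w2 x : classical x ->
      step (Code s (w1 ++ w2)) (Code s (w1 ++ [:: x; mate x] ++ w2))
  | VRI s w1 w2 x : virtual x ->
      step (Code s (w1 ++ w2)) (Code s (w1 ++ [:: x; mate x] ++ w2))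
  | RII s w1 w2 w3 x y o :
      classical x -> kind x = kind y -> lr x != lr y ->
      step (Code s (w1 ++ w2 ++ w3))
           (Code s (w1 ++ [:: x; y] ++ w2 ++ two o (mate x) (mate y) ++ w3))
  | VRII s w1 w2 w3 x y o :
      virtual x -> virtual y -> lr x != lr y ->
      step (Code s (w1 ++ w2 ++ w3))
           (Code s (w1 ++ [:: x; y] ++ w2 ++ two o (mate x) (mate y) ++ w3))
  | RIII_VRIII_SV s w1 w2 w3 w4 a b c o1 o2 o3 :
      triangle a b c o1 o2 o3 ->
      [|| RIII_type a b c, VRIII_type a b c | SV_type a b c] ->
      step (Code s (w1 ++ two o1 a b ++ w2 ++ two o2 (mate a) c ++ w3 ++
                    two o3 (mate b) (mate c) ++ w4))
           (Code s (w1 ++ two (~~ o1) a b ++ w2 ++ two (~~ o2) (mate a) c ++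
                    w3 ++ two (~~ o3) (mate b) (mate c) ++ w4)).

(* Two diagrams of the same oriented virtual knot.  All the intermediate      *)
(* codes are planar diagrams.                                                 *)
Definition same_virtual_knot : diagram -> diagram -> Prop :=
  clos_refl_sym_trans diagram (fun D D' : diagram => step D D').

Local Open Scope ring_scope.

(* C(D): a classical crossing has exactly one over-passage. *)
Definition crossings (D : code) : seq nat :=
  [seq name v | v <- word D & over v].

Definition sgn (D : code) (c : nat) : int :=
  if Passage c Over true \in word D then 1 else -1.

(* The passage of the strand of [c] coming from bottom left ([b = true]) or   *)
(* from bottom right ([b = false]).                                           *)
Definition pos (D : code) (c : nat) (b : bool) : nat :=
  find (fun v => (name v == c) && (lr v == b)) (word D).

(* From incoming labels a (bottom left) and b (bottom right) to outgoing      *)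
(* labels b + 1 (top left) and a - 1 (top right): labels change by -1 along   *)
(* the strand from bottom left, and by +1 along the other one.                *)
Definition jump (v : passage) : int :=
  if virtual v then 0 else if lr v then -1 else 1.

(* [lam i] is the label of the arc that enters passage [i]. *)
Definition labeling (D : code) (lam : nat -> int) : Prop :=
  forall i, (i < size (word D))%N ->
    lam (i.+1 %% size (word D))%N =
    lam i + jump (nth (Passage 0 Virtual true) (word D) i).

Definition index_from (D : code) (lam : nat -> int) (c : nat) : int :=
  sgn D c * (lam (pos D c true) - lam (pos D c false) - 1).

(* The labeling with label 0 at the base point. *)
Definition label (D : code) (i : nat) : int :=
  \sum_(v <- take i (word D)) jump v.

Definition Ind (D : code) (c : nat) : int := index_from D (label D) c.

Definition writhe (n : int) (D : code) : int :=
  \sum_(c <- crossings D | Ind D c == n) sgn D c.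

Definition dwrithe (n : nat) (D : code) : int :=
  writhe n%:Z D - writhe (- n%:Z) D.

Lemma sum_jump (w : seq passage) : matched w -> \sum_(v <- w) jump v = 0.
Proof.
case/andP=> w_uniq /allP w_mate.
have mateK : involutive mate by case=> n [] [].
have w_perm : perm_eq w (map mate w).
  apply: uniq_perm => //; first by rewrite (map_inj_uniq (can_inj mateK)).
  move=> v; apply/idP/mapP => [vw | [u uw ->]]; last by case/andP: (w_mate u uw).
  by exists (mate v); [case/andP: (w_mate v vw) | rewrite mateK].
have jump_mate v : jump (mate v) = - jump v.
  by case: v => n [] []; rewrite /jump ?oppr0 ?opprK.
have : \sum_(v <- w) jump v = - \sum_(v <- w) jump v.
  rewrite {1}(perm_big _ w_perm) big_map -sumrN.
  by apply: eq_bigr => v _; rewrite jump_mate.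
by move/eqP; rewrite -addr_eq0 -mulr2n mulrn_eq0 => /eqP.
Qed.

Lemma label_labeling (D : diagram) : labeling D (label D).
Proof.
have tot := sum_jump (diagram_matched D).
move=> i; set n := size _ => lt_in; set v0 := Passage _ _ _.
have -> : label D i + jump (nth v0 (word D) i) = label D i.+1.
  by rewrite /label (take_nth v0) // big_rcons /= addrC.
have [lt_Sn | ] := ltnP i.+1 n; first by rewrite modn_small.
move=> le_nS; have -> : i.+1 = n by apply/eqP; rewrite eqn_leq lt_in.
by rewrite modnn /label take0 big_nil take_size tot.
Qed.

(* The index does not depend on the labeling used. *)
Lemma Ind_labeling (D : diagram) (lam : nat -> int) (c : nat) :
  labeling D lam -> c \in crossings D -> index_from D lam c = Ind D c.
Proof.
move=> lamD /mapP[v]; rewrite mem_filter => /andP[_ vw] ->.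
have [_ /allP/(_ v vw)/andP[mw _]] := andP (diagram_matched D).
have lamE i : (i < size (word D))%N -> lam i = lam 0%N + label D i.
  elim: i => [_ | i IHi lt_iw]; first by rewrite /label take0 big_nil addr0.
  have lt_i := ltnW lt_iw; have := label_labeling lt_i; have := lamD i lt_i.
  by rewrite modn_small // => -> ->; rewrite IHi // addrA.
have pos_lt b : (pos D (name v) b < size (word D))%N.
  rewrite -has_find; apply/hasP.
  have [<- | ne_b] := eqVneq (lr v) b; first by exists v; rewrite ?eqxx.
  by exists (mate v); rewrite //= eqxx; case: (lr v) b ne_b => [] [].
by rewrite /Ind /index_from (lamE _ (pos_lt true)) (lamE _ (pos_lt false))
  opprD addrACA subrr add0r.
Qed.

(* Write the word of D as u x v y z where x and y are the passages through c. *)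
(* If x is the over-passage, then v keeps its orientation and the path z u,   *)
(* which contains the base point, is reversed (so that the two sides of the   *)
(* base point are exchanged): the result, read from the base point, is        *)
(* (rev z) v (rev u).  Otherwise v is reversed and the result is u (rev v) z. *)
(* If exactly one strand of a crossing is reversed, then the strand that came *)
(* from bottom left comes from bottom right once both are drawn upward again, *)
(* and conversely; if both or none are, [lr] is unchanged.  Exactly one       *)
(* strand is reversed iff exactly one passage through the crossing lies in v. *)

Definition smooth (D : code) (c : nat) : code :=
  let w := word D in
  let at_c t := name t == c in
  let i := find at_c w in
  let u := take i w in
  let r := drop i.+1 w in
  let j := find at_c r in
  let v := take j r in
  let z := drop j.+1 r in
  let flip t :=
    if count (fun t' => name t' == name t) v == 1%N
    then Passage (name t) (kind t) (~~ lr t) else t in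
  if has (fun t => at_c t && over t) (take i.+1 w) then
    Code (~~ out D) (map flip (rev z ++ v ++ rev u))
  else Code (out D) (map flip (u ++ rev v ++ z)).

(* L-polynomials, in Z[t, t^-1, l], a subring of the field Q(t, l).           *)

Notation fracZtl := {fraction {poly {poly int}}}.

Definition tvar : fracZtl := tofrac 'X.
Definition lvar : fracZtl := tofrac ('X)%:P.

Definition Lpoly (n : nat) (D : code) : fracZtl :=
  \sum_(c <- crossings D)
     (sgn D c)%:~R *
     (tvar ^ Ind D c * lvar ^+ `|dwrithe n (smooth D c)|%N
      - lvar ^+ `|dwrithe n D|%N).

(* Main.v *)
Require Import Defs.
From mathcomp Require Import all_boot all_order all_algebra.
From mathcomp Require Import zify ring.

Set Implicit Arguments.
Unset Strict Implicit.
Unset Printing Implicit Defensive.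

(** Virtual double points and regions of the plane do not enter the polynomial:
    it depends only on the signs of the classical crossings and on the order in
    which their passages are met.  View a crossing as a chord joining its two
    passages, and let [linking e d] count the ends of the chord [d] met on the
    way from the end of [e] coming from bottom right to its end coming from
    bottom left, each with the change of label that it causes.  The sum F(e) of
    these numbers over all [d] other than [e] is sgn(e) Ind(e) ([Ind_crossings]).

    A crossing change turns sgn(e) and Ind(e) into their opposites and keeps
    F(e), so that J_n - J_(-n) is the sum over e of [F(e) = n] - [F(e) = -n],
    where the signs of the crossings no longer occur ([dwrithe_crossings]).
    Smoothing [c] against the orientation reverses the order of the passages
    that lie between the two passages of [c], exchanges the two ends of each
    chord that crosses [c], and possibly reverses the whole knot, which replaces
    the dwrithe by its opposite.  The absolute value of the dwrithe of [D_c] is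
    therefore given by the same formula, with numbers [smooth_linking c e d] that
    depend only on the relative positions of three chords ([dwrithe_smooth]).
    This presents L as [gauss_poly], a function of names, signs and positions
    that sees positions only through their order.

    Virtual moves and SV do not change the order of the classical passages
    ([Lpoly_classical]).  Moving the base point across a passage preserves all
    linkings; if the passage belongs to [c], it replaces all the linkings of
    [D_c] by their opposites ([gauss_poly_rot]).

    The chord created by RI is linked with no other chord, in D or in any other
    smoothing, has index 0, and its smoothing has the linkings of D without the
    chord, so that its term vanishes ([gauss_poly_R1]).  The chords [x] and [y]
    created by RII have opposite linkings with every other chord, so that their
    contributions to every dwrithe cancel; they have opposite signs and equal
    indices, and [D_x] and [D_y] differ by the names of [y] and [x], so that
    their terms cancel ([gauss_poly_R2]).

    RIII exchanges the ends of chords in three places.  In D, and in [D_z] for any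
    chord [z] outside the triangle, it affects only linkings between chords of the
    triangle, and the sums F(e) are unchanged.  If [a], [b] and [c] are the chords
    of the triangle, then in [D_a] either [b] and [c] exchange their roles, or both
    before and after the move their sums F are opposite and do not contribute to
    the dwrithe; the sums F of the other chords are unchanged ([gauss_poly_R3]).
    These facts about the triangle, like the comparison of [D_x] and [D_y] for RII,
    involve the order of at most eight endpoints: replacing endpoints by their
    ranks leaves finitely many configurations, which are verified by computation
    ([R2_checked], [R3_checked]). *)

Import Order.TTheory GRing.Theory Num.Theory.

(* The predicate on passages, not the constant of the same name used by the
   [under] tactic. *)
Local Notation over := Defs.over.

Section Invariance.
Local Open Scope ring_scope.

(** * Linking numbers of chords *)

(** A chord is the pair of the positions of the passages of a crossing, the one
    coming from bottom left first.  Labels change by +1 at [d.2] and by -1 at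
    [d.1], and [linking lt e d] is the total change due to [d] on the way from
    [e.2] to [e.1], when positions are ordered by [lt]. *)
Definition linking (lt : rel nat) (e d : nat * nat) : int :=
  (lt d.2 e.1)%:Z - (lt d.1 e.1)%:Z - (lt d.2 e.2)%:Z + (lt d.1 e.2)%:Z.

Definition swap (e : nat * nat) : nat * nat := (e.2, e.1).

(** For a position other than those of [c]: it lies strictly between the two ends
    of [c], in any order. *)
Definition between (c : nat * nat) (p : nat) : bool :=
  (c.1 < p)%N (+) (c.2 < p)%N.

(** The order of the passages after smoothing [c]: the part of the word between
    the two passages of [c] is reversed. *)
Definition smooth_lt (c : nat * nat) : rel nat :=
  fun p q => if between c p && between c q then (q < p)%N else (p < q)%N.

(** The chord [e] after smoothing [c], at the original positions: if exactly one
    of its ends lies on the reversed part, then bottom left and bottom right are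
    exchanged. *)
Definition smooth_chord (c e : nat * nat) : nat * nat :=
  if between c e.1 (+) between c e.2 then swap e else e.

(** The linking of [e] and [d] in the diagram smoothed at [c]. *)
Definition smooth_linking (c e d : nat * nat) : int :=
  linking (smooth_lt c) (smooth_chord c e) (smooth_chord c d).

Lemma linking_swapl lt e d : linking lt (swap e) d = - linking lt e d.
Proof. by rewrite /linking /=; ring. Qed.

Lemma linking_swapr lt e d : linking lt e (swap d) = - linking lt e d.
Proof. by rewrite /linking /=; ring. Qed.

Lemma smooth_chord_swap c e : smooth_chord c (swap e) = swap (smooth_chord c e).
Proof. by rewrite /smooth_chord /= addbC; case: ifP. Qed.

Lemma smooth_linking_swapl c e d :
  smooth_linking c (swap e) d = - smooth_linking c e d.
Proof. by rewrite /smooth_linking smooth_chord_swap linking_swapl. Qed.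

Lemma smooth_linking_swapr c e d :
  smooth_linking c e (swap d) = - smooth_linking c e d.
Proof. by rewrite /smooth_linking smooth_chord_swap linking_swapr. Qed.

Lemma smooth_linking_swapc c e d :
  smooth_linking (swap c) e d = smooth_linking c e d.
Proof.
have betC p : between (swap c) p = between c p by rewrite /between /= addbC.
by rewrite /smooth_linking /linking /smooth_lt /smooth_chord !betC.
Qed.

(** [P c b] is the position of the passage of the crossing [c] coming from bottom
    left ([b = true]) or from bottom right ([b = false]). *)
Definition chord (P : nat -> bool -> nat) (c : nat) : nat * nat :=
  (P c true, P c false).

(** The two ends of one chord are not compared: no linking depends on their
    order. *)
Definition same_order (A : seq nat) (P P' : nat -> bool -> nat) : Prop :=
  {in A &, forall e d b b', e != d -> (P e b < P d b')%N = (P' e b < P' d b')%N}.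

Lemma linking_ext P P' e d : e != d -> same_order [:: e; d] P P' ->
  linking ltn (chord P e) (chord P d) = linking ltn (chord P' e) (chord P' d).
Proof.
by move=> ed PP'; rewrite /linking /= !PP' ?inE ?eqxx ?orbT // eq_sym.
Qed.

Lemma chord_smooth P c e :
  smooth_chord (chord P c) (chord P e) =
  let fl := between (chord P c) (P e true) (+) between (chord P c) (P e false)
  in (P e (~~ fl), P e fl).
Proof. by rewrite /smooth_chord /=; case: (_ (+) _). Qed.

Lemma smooth_linking_ext P P' c e d : uniq [:: c; e; d] ->
  same_order [:: c; e; d] P P' ->
  smooth_linking (chord P c) (chord P e) (chord P d) =
  smooth_linking (chord P' c) (chord P' e) (chord P' d).
Proof.
rewrite /= !inE negb_or andbT => /andP[/andP[ce cd] ed] PP'.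
have [es ds] : e \in [:: c; e; d] /\ d \in [:: c; e; d].
  by rewrite !inE !eqxx !orbT.
have bet x b : x \in [:: c; e; d] -> c != x ->
    between (chord P c) (P x b) = between (chord P' c) (P' x b).
  by move=> xs cx; rewrite /between /= !PP' // inE eqxx.
have lt b b' : smooth_lt (chord P c) (P d b) (P e b') =
               smooth_lt (chord P' c) (P' d b) (P' e b').
  by rewrite /smooth_lt !bet // !PP' // eq_sym.
by rewrite /smooth_linking !chord_smooth /linking /= !bet // !lt.
Qed.

Definition uniq_ends (e d : nat * nat) := uniq [:: e.1; e.2; d.1; d.2].

Lemma linkingC e d : uniq_ends e d -> linking ltn e d = - linking ltn d e.
Proof.
case: e d => [e1 e2] [d1 d2]; rewrite /uniq_ends /= !inE !negb_or => U.
have ltC p q : p != q -> (p < q)%N%:Z = 1 - (q < p)%N%:Z by case: ltngtP.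
case/and4P: U => /and3P[n1 n2 n3] /andP[n4 n5] n6 _.
rewrite /linking /= (ltC e1 d1) // (ltC e1 d2) // (ltC e2 d1) // (ltC e2 d2) //.
by ring.
Qed.

Lemma smooth_linkingC c e d : uniq_ends e d ->
  smooth_linking c e d = - smooth_linking c d e.
Proof.
case: e d => [e1 e2] [d1 d2]; rewrite /uniq_ends /= !inE !negb_or => U.
have ltC p q : p != q -> (smooth_lt c p q)%:Z = 1 - (smooth_lt c q p)%:Z.
  by rewrite /smooth_lt andbC; case: (_ && _); case: ltngtP.
case/and4P: U => /and3P[n1 n2 n3] /andP[n4 n5] n6 _.
rewrite /smooth_linking /smooth_chord.
by do 2 case: (_ (+) _); rewrite /linking /= (ltC e1 d1) // (ltC e1 d2) //
  (ltC e2 d1) // (ltC e2 d2) //; ring.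
Qed.

(** * The polynomial of a family of signed chords *)

(** The contribution to the [n]-th dwrithe of a crossing with sgn * Ind = [k]. *)
Definition weight (n : nat) (k : int) : int := (k == n%:Z)%:Z - (k == - n%:Z)%:Z.

Lemma weightN n k : weight n (- k) = - weight n k.
Proof. by rewrite /weight eqr_opp eqr_oppLR opprB. Qed.

Lemma weight0 n : weight n 0 = 0.
Proof. by rewrite /weight !(eq_sym 0) oppr_eq0 subrr. Qed.

(** The [n]-th dwrithe of a family [C] of chords with linking numbers [M]. *)
Definition dwrithe_of (n : nat) (C : seq nat) (M : nat -> nat -> int) : int :=
  \sum_(e <- C) weight n (\sum_(d <- C) M e d).

Lemma dwrithe_of_perm n C C' M : perm_eq C C' ->
  dwrithe_of n C M = dwrithe_of n C' M.
Proof.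
move=> CC'; rewrite /dwrithe_of (perm_big _ CC').
by apply: eq_bigr => e _; rewrite (perm_big _ CC').
Qed.

Lemma dwrithe_of_ext n C M M' :
  {in C &, forall e d, M e d = M' e d} -> dwrithe_of n C M = dwrithe_of n C M'.
Proof.
move=> MM'; apply: eq_big_seq => e eC; congr weight.
by apply: eq_big_seq => d dC; apply: MM'.
Qed.

Lemma dwrithe_ofN n C M M' :
  {in C &, forall e d, M e d = - M' e d} -> dwrithe_of n C M = - dwrithe_of n C M'.
Proof.
move=> MM'; rewrite /dwrithe_of -sumrN; apply: eq_big_seq => e eC.
rewrite -weightN -sumrN; congr weight.
by apply: eq_big_seq => d dC; apply: MM'.
Qed.

(** The linking numbers in a diagram and in its smoothing at [c]; the diagonal is
    set to 0, since a chord does not contribute to its own index. *)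
Definition index_matrix (P : nat -> bool -> nat) (e d : nat) : int :=
  if e == d then 0 else linking ltn (chord P e) (chord P d).

Definition smooth_matrix (P : nat -> bool -> nat) (c e d : nat) : int :=
  if e == d then 0 else smooth_linking (chord P c) (chord P e) (chord P d).

Lemma index_matrix_diag P e : index_matrix P e e = 0.
Proof. by rewrite /index_matrix eqxx. Qed.

Lemma smooth_matrix_diag P c e : smooth_matrix P c e e = 0.
Proof. by rewrite /smooth_matrix eqxx. Qed.

(** The term of the crossing [c] in the L-polynomial, for crossings with names
    [C], signs [sg] and positions [P]. *)
Definition gauss_term (n : nat) (C : seq nat) (sg : nat -> int)
    (P : nat -> bool -> nat) (c : nat) : fracZtl :=
  (sg c)%:~R *
  (tvar ^ (sg c * \sum_(d <- C) index_matrix P c d) *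
   lvar ^+ `|dwrithe_of n (rem c C) (smooth_matrix P c)|%N
   - lvar ^+ `|dwrithe_of n C (index_matrix P)|%N).

Definition gauss_poly n C sg P : fracZtl :=
  \sum_(c <- C) gauss_term n C sg P c.

Lemma gauss_poly_perm n C C' sg P : perm_eq C C' ->
  gauss_poly n C sg P = gauss_poly n C' sg P.
Proof.
move=> CC'; rewrite /gauss_poly (perm_big _ CC'); apply: eq_bigr => c _.
rewrite /gauss_term (perm_big _ CC') (dwrithe_of_perm _ _ CC').
rewrite (@dwrithe_of_perm _ _ (rem c C')) //.
have [cC|cC] := boolP (c \in C'); last first.
  by rewrite !rem_id // (perm_mem CC').
rewrite -(perm_cons c) -(permPl (perm_to_rem _)) ?(perm_mem CC') //.
by rewrite (permPl CC') perm_to_rem.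
Qed.

(** The polynomial depends on the linking numbers in the diagram only through
    their sums over rows. *)
Lemma gauss_poly_ext n C sg sg' P P' : uniq C ->
  {in C, sg =1 sg'} ->
  {in C, forall c, \sum_(d <- C) index_matrix P c d =
                   \sum_(d <- C) index_matrix P' c d} ->
  {in C, forall c, `|dwrithe_of n (rem c C) (smooth_matrix P c)|%N =
                   `|dwrithe_of n (rem c C) (smooth_matrix P' c)|%N} ->
  gauss_poly n C sg P = gauss_poly n C sg' P'.
Proof.
move=> uC sgE rowE smE; apply: eq_big_seq => c cC.
rewrite /gauss_term sgE // rowE // smE //; congr (_ * (_ - _ ^+ `|_|%N)).
by apply: eq_big_seq => e eC; rewrite rowE.
Qed.

Lemma gauss_poly_same_order n C sg sg' P P' : uniq C ->
  {in C, sg =1 sg'} -> same_order C P P' ->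
  gauss_poly n C sg P = gauss_poly n C sg' P'.
Proof.
move=> uC sgE PP'; apply: gauss_poly_ext => // c cC.
  apply: eq_big_seq => d dC; rewrite /index_matrix; case: eqVneq => // cd.
  by apply: linking_ext => // x y; rewrite !inE => /orP[]/eqP-> /orP[]/eqP->;
    apply: PP'.
congr absz; apply: dwrithe_of_ext => e d.
rewrite !mem_rem_uniq // !inE => /andP[ec eC] /andP[dc dC].
rewrite /smooth_matrix; case: eqVneq => // ed; apply: smooth_linking_ext.
  by rewrite /= !inE negb_or !(eq_sym c) ec dc ed.
by move=> x y; rewrite !inE => /or3P[]/eqP-> /or3P[]/eqP->; apply: PP'.
Qed.

(** * Moving the base point *)
Definition distinct_ends (C : seq nat) (P : nat -> bool -> nat) : Prop :=
  {in C &, forall e d b b', P e b = P d b' -> e = d /\ b = b'}.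

(** The order of positions when the first passage is moved to the end of a word
    of length [N]. *)
Definition shift0 (N p : nat) : nat := if p == 0%N then N else p.

(** The comparison changes by a difference of functions of one position, and
    such a difference cancels in [linking]. *)
Lemma shift0_lt N p q : (p < N)%N -> (q < N)%N ->
  (shift0 N p < shift0 N q)%N%:Z =
    (p < q)%N%:Z - (p == 0%N)%:Z + (q == 0%N)%:Z.
Proof.
by rewrite /shift0; case: eqP => p0; case: eqP => q0 pN qN; lia.
Qed.

Definition map_chord (f : nat -> nat) (e : nat * nat) := (f e.1, f e.2).

Lemma map_chord_swap f e : map_chord f (swap e) = swap (map_chord f e).
Proof. by []. Qed.

Lemma linking_shift0 N e d :
  all (gtn N) [:: e.1; e.2; d.1; d.2] ->
  linking ltn (map_chord (shift0 N) e) (map_chord (shift0 N) d) =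
  linking ltn e d.
Proof.
case/and5P=> /= e1 e2 d1 d2 _; rewrite /linking /= !shift0_lt //; ring.
Qed.

(** If the moved passage belongs to [c], then inside and outside of [c] are
    exchanged, which amounts to reversing the smoothed word. *)
Lemma smooth_linking_shift0 N c e d :
  all (gtn N) [:: c.1; c.2; e.1; e.2; d.1; d.2] ->
  uniq [:: c.1; c.2; e.1; e.2; d.1; d.2] ->
  smooth_linking (map_chord (shift0 N) c) (map_chord (shift0 N) e)
                 (map_chord (shift0 N) d) =
  if (c.1 == 0%N) || (c.2 == 0%N) then - smooth_linking c e d
  else smooth_linking c e d.
Proof.
wlog c2 : c / c.2 != 0%N => [IH|].
  have [nz | ] := boolP (c.2 != 0%N); first exact: IH nz.
  rewrite negbK => c20 Nall U.
  have c1 : c.1 != 0%N.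
    by apply: contraTneq U => c10; rewrite c10 (eqP c20).
  have := IH (swap c) c1; rewrite map_chord_swap !smooth_linking_swapc orbC.
  apply; first by move: Nall; rewrite /= andbCA.
  by rewrite (uniq_catCA [:: c.2] [:: c.1]).
move=> /allP sN U; rewrite (negPf c2) orbF.
set B := [:: e.1; e.2; d.1; d.2] in sN U.
have {U} /and3P[c1B c2B uB] : uniq (c.1 :: c.2 :: B) := U.
have nc p : p \in B -> (p != c.1) && (p != c.2).
  move=> pB; rewrite (memPn c2B) // (memPn c1B) //.
  by rewrite in_cons pB orbT.
have [e1 e2 d1 d2] : [/\ e.1 \in B, e.2 \in B, d.1 \in B & d.2 \in B].
  by rewrite !inE !eqxx !orbT.
have BN p : p \in B -> (p < N)%N.
  by move=> pB; apply: sN; rewrite 2!in_cons pB !orbT.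
have c1N : (c.1 < N)%N by apply: sN; rewrite mem_head.
have c2N : (c.2 < N)%N by apply: sN; rewrite !inE eqxx orbT.
have sc2 : shift0 N c.2 = c.2 by rewrite /shift0 (negPf c2).
(* If no end of [c] moves, then the moved position lies outside of [c]. *)
have [c10|c1] := eqVneq c.1 0%N; last first.
  have sc1 : shift0 N c.1 = c.1 by rewrite /shift0 (negPf c1).
  have bet p : p \in B ->
     between (map_chord (shift0 N) c) (shift0 N p) = between c p.
    move=> pB; rewrite /between /= sc1 sc2 /shift0.
    by case: eqP => // ->; rewrite c1N c2N.
  have lt p q : p \in B -> q \in B ->
    (smooth_lt (map_chord (shift0 N) c) (shift0 N p) (shift0 N q))%:Z =
    (smooth_lt c p q)%:Z - (p == 0%N)%:Z + (q == 0%N)%:Z.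
    move=> pB qB; rewrite /smooth_lt !bet //; case: ifP; last first.
      by move=> _; rewrite shift0_lt // BN.
    case/andP=> bp bq.
    have n0 r : between c r -> (r == 0%N) = false.
      by rewrite /between; case: r => //; rewrite !ltn0.
    by rewrite shift0_lt ?BN // !n0 //; ring.
  rewrite /smooth_linking /smooth_chord /= !bet //.
  by do 2 case: (_ (+) _); rewrite /linking /= !lt //; ring.
(* Otherwise the positions outside of [c] become those between its ends. *)
have sc1 : shift0 N c.1 = N by rewrite /shift0 c10.
have nz p : p \in B -> (0 < p)%N.
  by move/nc; rewrite c10 lt0n => /andP[].
have shE p : p \in B -> shift0 N p = p.
  by move/nz => p0; rewrite /shift0 gtn_eqF.
have bet p : p \in B ->
   between (map_chord (shift0 N) c) p = ~~ between c p.
  move=> pB; rewrite /between /= sc1 sc2 c10 nz // ltnNge ltnW ?BN //=.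
  by rewrite negbK.
have lt p q : p \in B -> q \in B -> p != q ->
  (smooth_lt (map_chord (shift0 N) c) p q)%:Z =
  1 - (smooth_lt c p q)%:Z + (p < c.2)%N%:Z - (q < c.2)%N%:Z.
  move=> pB qB pq; rewrite /smooth_lt !bet // /between c10 !nz //= !negbK.
  case/andP: (nc _ pB) => _; case/andP: (nc _ qB) => _.
  case: (ltngtP q c.2) => // qc _; case: (ltngtP p c.2) => // pc _ /=;
    by clear - pq qc pc; lia.
have [n1 n2 n3 n4] : [/\ d.2 != e.1, d.1 != e.1, d.2 != e.2 & d.1 != e.2].
  move: uB; rewrite /B /= !inE !negb_or !(eq_sym d.1) !(eq_sym d.2).
  by case/and4P=> /and3P[_ -> ->] /andP[-> ->].
rewrite /smooth_linking {3 5}/map_chord (shE e.1) // (shE e.2) //.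
rewrite (shE d.1) // (shE d.2) //.
set c' := map_chord _ c in bet lt *; clearbody c'.
rewrite /smooth_chord /= !bet // !addNb !addbN !negbK.
by do 2 case: (_ (+) _); rewrite /linking /= !lt //; ring.
Qed.

Lemma distinct_ends_uniq C P s : distinct_ends C P -> uniq s ->
  {subset s <= C} -> uniq [seq P c b | c <- s, b <- [:: true; false]].
Proof.
move=> inj us sC; apply: allpairs_uniq => // -[c b] [c' b'].
move=> /(@allpairsPdep _ _ _)[u [v [us1 _ [-> ->]]]].
move=> /(@allpairsPdep _ _ _)[u' [v' [us2 _ [-> ->]]]] E.
by have [-> ->] := inj u u' (sC _ us1) (sC _ us2) v v' E.
Qed.

Lemma gauss_poly_rot n C sg P N : uniq C -> distinct_ends C P ->
  {in C, forall c b, P c b < N}%N ->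
  gauss_poly n C sg (fun c b => shift0 N (P c b)) = gauss_poly n C sg P.
Proof.
move=> uC inj PN; apply: gauss_poly_ext => // c cC.
  apply: eq_big_seq => d dC; rewrite /index_matrix; case: eqVneq => // cd.
  by apply: (@linking_shift0 N (chord P c) (chord P d)); rewrite /= !PN.
have bound e d : e \in rem c C -> d \in rem c C -> e != d ->
    all (gtn N) [:: P c true; P c false; P e true; P e false; P d true; P d false]
    /\ uniq [:: P c true; P c false; P e true; P e false; P d true; P d false].
  rewrite !mem_rem_uniq // !inE => /andP[ec eC] /andP[dc dC] ed.
  split; first by rewrite /= !PN.
  apply: (distinct_ends_uniq (s := [:: c; e; d]) inj).
    by rewrite /= !inE negb_or !(eq_sym c) ec dc ed.
  by move=> x; rewrite !inE => /or3P[]/eqP->.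
have sm e d : e \in rem c C -> d \in rem c C ->
    smooth_matrix (fun c b => shift0 N (P c b)) c e d =
    if (P c true == 0%N) || (P c false == 0%N) then - smooth_matrix P c e d
    else smooth_matrix P c e d.
  move=> ec dc; rewrite /smooth_matrix; case: eqVneq => [|ed].
    by rewrite oppr0; case: ifP.
  have [bN bU] := bound e d ec dc ed.
  exact: (@smooth_linking_shift0 N (chord P c) (chord P e) (chord P d)).
case: (_ || _) sm => sm; last by congr absz; apply: dwrithe_of_ext.
by rewrite -[in RHS]abszN; congr absz; apply: dwrithe_ofN.
Qed.

(** * Order-preserving relabelling by ranks *)

(** The number of elements of [L] smaller than [x]; it preserves the order of the
    elements of [L] and takes values below the size of [L]. *)
Definition rank (L : seq nat) (x : nat) : nat := count (gtn x) L.

Lemma rank_leq L x y : (x <= y)%N -> (rank L x <= rank L y)%N.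
Proof. by move=> xy; apply: sub_count => z /= zx; apply: leq_trans xy. Qed.

Lemma rankS L x : uniq L -> x \in L -> rank L x.+1 = (rank L x).+1.
Proof.
move=> uL xL; rewrite /rank.
rewrite (@eq_count _ (gtn x.+1) (predU (gtn x) (pred1 x))); last first.
  by move=> z /=; rewrite ltnS leq_eqVlt orbC.
rewrite -[LHS]addn0 -[X in (_ + X)%N](count_pred0 L).
rewrite -[X in (_ + X)%N](@eq_count _ (predI (gtn x) (pred1 x))); last first.
  by move=> z /=; case: ltngtP.
by rewrite count_predUI (count_uniq_mem x uL) xL addn1.
Qed.

Lemma rank_lt L : uniq L ->
  {in L &, forall x y, (rank L x < rank L y)%N = (x < y)%N}.
Proof.
move=> uL x y xL yL; case: (ltnP x y) => [xy | yx]; last first.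
  by apply/negbTE; rewrite -leqNgt rank_leq.
by rewrite -rankS // rank_leq.
Qed.

Lemma rank_size L x : x \in L -> (rank L x < size L)%N.
Proof.
move=> xL; rewrite -(count_predC (gtn x) L) -[X in (X < _)%N]addn0 ltn_add2l.
by rewrite -has_count; apply/hasP; exists x => //=; rewrite ltnn.
Qed.

Lemma rank_inj L : uniq L -> {in L &, injective (rank L)}.
Proof.
move=> uL x y xL yL E.
move: (rank_lt uL xL yL) (rank_lt uL yL xL); rewrite E ltnn.
by case: ltngtP.
Qed.

Lemma rank_iota L x : x \in L -> rank L x \in iota 0 (size L).
Proof. by rewrite mem_iota; apply: rank_size. Qed.

Lemma smooth_linking_mono (f : nat -> nat) (L : seq nat) c e d :
  {in L &, forall x y, (f x < f y)%N = (x < y)%N} ->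
  {subset [:: c.1; c.2; e.1; e.2; d.1; d.2] <= L} ->
  smooth_linking (map_chord f c) (map_chord f e) (map_chord f d) =
  smooth_linking c e d.
Proof.
move=> fL sL; pose ends i := nth c [:: c; e; d] i.
pose P i (b : bool) := if b then (ends i).1 else (ends i).2.
have chordP i : chord P i = ends i by rewrite /chord /P; case: (ends i).
have := @smooth_linking_ext P (fun i b => f (P i b)) 0 1 2 isT.
rewrite !chordP => ->; first by rewrite /chord /P /=.
have PL i b : i \in [:: 0; 1; 2]%N -> P i b \in L.
  rewrite !inE => /or3P[] /eqP->; apply: sL; rewrite /P /ends;
    by case: b; rewrite /= !inE eqxx ?orbT.
by move=> i j iI jI b b' _; rewrite fL ?PL.
Qed.

Lemma linking_mono (f : nat -> nat) (L : seq nat) e d :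
  {in L &, forall x y, (f x < f y)%N = (x < y)%N} ->
  {subset [:: e.1; e.2; d.1; d.2] <= L} ->
  linking ltn (map_chord f e) (map_chord f d) = linking ltn e d.
Proof.
by move=> fL sL; rewrite /linking /= !fL // sL // !inE eqxx ?orbT.
Qed.

(** * First and second moves on chords *)

(** The chords [x] and the opposite of [y] cannot be told apart by their position
    relative to the chords of [C].  For [x = y] this says that the two ends of [x]
    have the same position relative to [C], as for an isolated chord. *)
Definition antiparallel (C : seq nat) (P : nat -> bool -> nat) (x y : nat) :=
  {in C, forall e b b', (P e b < P x b')%N = (P e b < P y (~~ b'))%N /\
                        (P x b' < P e b)%N = (P y (~~ b') < P e b)%N}.

(** Positions with the opposite of the chord [y] put in place of [x]. *)
Definition replace_chord (P : nat -> bool -> nat) x y e (b : bool) : nat :=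
  if e == x then P y (~~ b) else P e b.

Lemma chord_replace P x y : chord (replace_chord P x y) x = swap (chord P y).
Proof. by rewrite /chord /replace_chord eqxx. Qed.

Lemma chord_replace_neq P x y e : e != x ->
  chord (replace_chord P x y) e = chord P e.
Proof. by rewrite /chord /replace_chord => /negPf->. Qed.

Lemma same_order_replace C P x y s : antiparallel C P x y ->
  {subset s <= x :: C} -> same_order s P (replace_chord P x y).
Proof.
move=> anti sC e d es ds b b' ed; rewrite /replace_chord.
move: (sC _ es) (sC _ ds); rewrite !in_cons.
case: (eqVneq e x) => [ex|ex] /= eC; case: (eqVneq d x) => [dx|dx] //= dC.
- by rewrite ex dx eqxx in ed.
- by rewrite ex; have [_ ->] := anti d dC b' b.
- by rewrite dx; have [-> _] := anti e eC b b'.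
Qed.

Section Antiparallel.
Variables (C : seq nat) (P : nat -> bool -> nat) (x y : nat).
Hypothesis anti : antiparallel C P x y.
Hypothesis xC : x \notin C.

Let neq_x e : e \in C -> e != x.
Proof. by move=> eC; apply: contraNneq xC => <-. Qed.

Lemma antiparallel_linkingr e : e \in C ->
  linking ltn (chord P e) (chord P x) = - linking ltn (chord P e) (chord P y).
Proof.
move=> eC; have ex := neq_x eC.
rewrite (linking_ext (P' := replace_chord P x y)) //; last first.
  apply: same_order_replace anti _ => z.
  by rewrite !inE => /orP[]/eqP-> ; rewrite ?eC ?eqxx ?orbT.
by rewrite chord_replace chord_replace_neq // linking_swapr.
Qed.

Lemma antiparallel_linkingl e : e \in C ->
  linking ltn (chord P x) (chord P e) = - linking ltn (chord P y) (chord P e).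
Proof.
move=> eC; have ex := neq_x eC.
rewrite (linking_ext (P' := replace_chord P x y)) 1?eq_sym //; last first.
  apply: same_order_replace anti _ => z.
  by rewrite !inE => /orP[]/eqP-> ; rewrite ?eC ?eqxx ?orbT.
by rewrite chord_replace chord_replace_neq // linking_swapl.
Qed.

Lemma antiparallel_smooth_linkingr c e : c \in C -> e \in C -> c != e ->
  smooth_linking (chord P c) (chord P e) (chord P x) =
  - smooth_linking (chord P c) (chord P e) (chord P y).
Proof.
move=> cC eC ce; have [cx ex] := (neq_x cC, neq_x eC).
rewrite (smooth_linking_ext (P' := replace_chord P x y)); first 1 last.
- by rewrite /= !inE negb_or ce cx ex.
- apply: same_order_replace anti _ => z.
  by rewrite !inE => /or3P[]/eqP-> ; rewrite ?eC ?cC ?eqxx ?orbT.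
by rewrite chord_replace !chord_replace_neq // smooth_linking_swapr.
Qed.

Lemma antiparallel_smooth_linkingl c e : c \in C -> e \in C -> c != e ->
  smooth_linking (chord P c) (chord P x) (chord P e) =
  - smooth_linking (chord P c) (chord P y) (chord P e).
Proof.
move=> cC eC ce; have [cx ex] := (neq_x cC, neq_x eC).
rewrite (smooth_linking_ext (P' := replace_chord P x y)); first 1 last.
- by rewrite /= !inE negb_or ce cx (eq_sym x) ex.
- apply: same_order_replace anti _ => z.
  by rewrite !inE => /or3P[]/eqP-> ; rewrite ?eC ?cC ?eqxx ?orbT.
by rewrite chord_replace !chord_replace_neq // smooth_linking_swapl.
Qed.

Lemma antiparallel_smooth_linkingc e d : e \in C -> d \in C -> e != d ->
  smooth_linking (chord P x) (chord P e) (chord P d) =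
  smooth_linking (chord P y) (chord P e) (chord P d).
Proof.
move=> eC dC ed; have [ex dx] := (neq_x eC, neq_x dC).
rewrite (smooth_linking_ext (P' := replace_chord P x y)); first 1 last.
- by rewrite /= !inE negb_or !(eq_sym x) ed ex dx.
- apply: same_order_replace anti _ => z.
  by rewrite !inE => /or3P[]/eqP-> ; rewrite ?eC ?dC ?eqxx ?orbT.
by rewrite chord_replace !chord_replace_neq // smooth_linking_swapc.
Qed.
End Antiparallel.

Lemma dwrithe_of_null n C (M : nat -> nat -> int) x :
  {in C, forall e, M e x = 0} -> {in x :: C, forall e, M x e = 0} ->
  dwrithe_of n (x :: C) M = dwrithe_of n C M.
Proof.
move=> Mx0 M0x; rewrite /dwrithe_of big_cons big1_seq; last first.
  by move=> e /andP[_ /M0x].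
rewrite weight0 add0r; apply: eq_big_seq => e eC.
by rewrite big_cons Mx0 // add0r.
Qed.

Lemma dwrithe_of_cancel n C (M : nat -> nat -> int) x y :
  {in C, forall e, M e x = - M e y} ->
  \sum_(d <- x :: y :: C) M x d = - (\sum_(d <- x :: y :: C) M y d) ->
  dwrithe_of n (x :: y :: C) M = dwrithe_of n C M.
Proof.
move=> Me row; rewrite /dwrithe_of big_cons [X in _ + X]big_cons row weightN.
rewrite addKr; apply: eq_big_seq => e eC.
by rewrite big_cons [X in _ + X]big_cons Me // addKr.
Qed.

Lemma gauss_poly_R1 n C sg P x : uniq (x :: C) ->
  antiparallel C P x x -> gauss_poly n (x :: C) sg P = gauss_poly n C sg P.
Proof.
move=> /andP[xC uC] anti.
have self (k : int) : k = - k -> k = 0 by lia.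
have neq_x e : e \in C -> (e == x) = false.
  by move=> eC; apply: contraNF xC => /eqP<-.
have M0 e : e \in C -> index_matrix P e x = 0.
  move=> eC; rewrite /index_matrix neq_x //.
  by apply: self; apply: antiparallel_linkingr eC.
have M0' e : e \in x :: C -> index_matrix P x e = 0.
  rewrite in_cons /index_matrix eq_sym; case: eqVneq => // ex /= eC.
  by apply: self; apply: antiparallel_linkingl eC.
have W0 : dwrithe_of n (x :: C) (index_matrix P) = dwrithe_of n C (index_matrix P).
  exact: dwrithe_of_null.
have term_x : gauss_term n (x :: C) sg P x = 0.
  rewrite /gauss_term big1_seq => [|e /M0' //]; rewrite mulr0 expr0z mul1r /= eqxx.
  rewrite W0 (@dwrithe_of_ext _ _ _ (index_matrix P)) ?subrr ?mulr0 //.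
  move=> e d eC dC; rewrite /smooth_matrix /index_matrix; case: ifP => // _.
  have out z b : z \in C -> between (chord P x) (P z b) = false.
    move=> zC; rewrite /between /=.
    by have [_ ->] := anti z zC b true; rewrite addbb.
  rewrite /smooth_linking /smooth_chord /= !out //= /linking /smooth_lt /=.
  by rewrite !out.
rewrite /gauss_poly big_cons term_x add0r; apply: eq_big_seq => c cC.
have cx := neq_x c cC.
rewrite /gauss_term W0 big_cons M0 // add0r /= eq_sym cx.
congr (_ * (_ * _ ^+ `|_|%N - _)); apply: dwrithe_of_null.
  move=> e; rewrite mem_rem_uniq // => /andP[/= ec eC].
  rewrite /smooth_matrix neq_x //; apply: self.
  by apply: (antiparallel_smooth_linkingr anti xC cC eC); rewrite eq_sym.
move=> e; rewrite in_cons mem_rem_uniq // /smooth_matrix (eq_sym x).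
case: (eqVneq e x) => //= ex /andP[/= ec eC]; apply: self.
by apply: (antiparallel_smooth_linkingl anti xC cC eC); rewrite eq_sym.
Qed.

(** For chords [x] and [y] created by RII at the positions [k], [k + 1], [m] and
    [m + 1], where [x] comes from bottom left at [k]: any other chord [(p, q)] has
    the same linking with [y] in the smoothing at [x] as with [x] in the smoothing
    at [y]. *)
Definition R2_check (k m p q : nat) : bool :=
  all (fun o : bool =>
    let x := (k, (m + ~~ o)%N) in let y := ((m + o)%N, k.+1) in
    smooth_linking x (p, q) y == smooth_linking y (p, q) x) [:: true; false].

Lemma R2_checked :
  all (fun k => all (fun m => all (fun p => all (fun q =>
    if uniq [:: k; k.+1; m; m.+1; p; q] then R2_check k m p q else true)
    (iota 0 6)) (iota 0 6)) (iota 0 6)) (iota 0 6).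
Proof. by vm_compute. Qed.

Lemma R2_check_transfer k m p q : uniq [:: k; k.+1; m; m.+1; p; q] ->
  R2_check k m p q.
Proof.
set L := [:: _; _; _; _; _; _] => uL; pose f := rank L.
have fL : {in L &, forall x y, (f x < f y)%N = (x < y)%N} := rank_lt uL.
have [kL k1L mL m1L] : [/\ k \in L, k.+1 \in L, m \in L & m.+1 \in L].
  by rewrite !inE !eqxx !orbT.
have [pL qL] : p \in L /\ q \in L by rewrite !inE !eqxx !orbT.
have fS x : x \in L -> f x.+1 = (f x).+1 by apply: rankS.
have f6 x : x \in L -> f x \in iota 0 6 by apply: rank_iota.
have finj : {in L &, injective f} := rank_inj uL.
have uf : uniq [:: f k; (f k).+1; f m; (f m).+1; f p; f q].
  by rewrite -!fS //; rewrite -[X in uniq X]/(map f L) map_inj_in_uniq.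
have := R2_checked.
move=> /allP/(_ _ (f6 _ kL)) /allP/(_ _ (f6 _ mL)).
move=> /allP/(_ _ (f6 _ pL)) /allP/(_ _ (f6 _ qL)).
rewrite uf => /allP chk; apply/allP => o /chk /=.
have mo (b : bool) : (f m + b)%N = f (m + b)%N.
  by case: b => /=; rewrite ?addn0 // !addn1 fS.
have moL (b : bool) : (m + b)%N \in L by case: b => /=; rewrite ?addn0 ?addn1.
have mono := fun c e d => @smooth_linking_mono f L c e d fL.
rewrite !mo -fS // (mono (k, (m + ~~ o)%N) (p, q) ((m + o)%N, k.+1)).
  rewrite (mono ((m + o)%N, k.+1) (p, q) (k, (m + ~~ o)%N)) //.
  by apply/allP; rewrite /= !moL pL qL kL k1L.
by apply/allP; rewrite /= !moL pL qL kL k1L.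
Qed.

Lemma gauss_poly_R2 n C sg P x y lx o k m :
  uniq (x :: y :: C) -> distinct_ends (x :: y :: C) P ->
  P x lx = k -> P y (~~ lx) = k.+1 ->
  P x (~~ lx) = (m + ~~ o)%N -> P y lx = (m + o)%N -> (k.+1 < m)%N ->
  sg x = - sg y ->
  gauss_poly n (x :: y :: C) sg P = gauss_poly n C sg P.
Proof.
move=> uxyC inj Pxk Pyk Pxm Pym km sgxy.
have [xyC yC uC] := and3P uxyC.
have [xy xC] : x != y /\ x \notin C by apply/andP; rewrite -negb_or -in_cons.
have inC e : e \in C -> e \in x :: y :: C by rewrite !in_cons => ->; rewrite !orbT.
have xin : x \in x :: y :: C by rewrite mem_head.
have yin : y \in x :: y :: C by rewrite !in_cons eqxx orbT.
have neqx e : e \in C -> (e == x) = false.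
  by move=> eC; apply: contraNF xC => /eqP<-.
have neqy e : e \in C -> (e == y) = false.
  by move=> eC; apply: contraNF yC => /eqP<-.
have out e b : e \in C ->
    [/\ P e b != k, P e b != k.+1, P e b != m & P e b != m.+1].
  move=> eC.
  have nx b' : P e b != P x b'.
    by apply: contraFneq (neqx e eC) => /(inj e x (inC e eC) xin)[-> _].
  have ny b' : P e b != P y b'.
    by apply: contraFneq (neqy e eC) => /(inj e y (inC e eC) yin)[-> _].
  have := (nx lx, nx (~~ lx), ny lx, ny (~~ lx)).
  by rewrite Pxk Pyk Pxm Pym; case: (o); rewrite /= ?addn0 ?addn1 => -[[[-> ->] ->] ->].
have anti : antiparallel C P x y.
  move=> e eC b b'; have [nk nk1 nm nm1] := out e b eC.
  have [->|->] : b' = lx \/ b' = ~~ lx by case: (b') (lx) => [] []; auto.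
    rewrite Pxk Pyk; move: nk nk1; clear; lia.
  rewrite negbK Pxm Pym; move: nm nm1; clear; case: (o); lia.
have Mr e : e \in C -> index_matrix P e x = - index_matrix P e y.
  by move=> eC; rewrite /index_matrix neqx // neqy // (antiparallel_linkingr anti).
have Ml e : e \in C -> index_matrix P x e = - index_matrix P y e.
  move=> eC; rewrite /index_matrix ![_ == e]eq_sym neqx // neqy //.
  by rewrite (antiparallel_linkingl anti).
have ends2 : uniq_ends (chord P x) (chord P y).
  apply: (distinct_ends_uniq (s := [:: x; y]) inj); first by rewrite /= inE xy.
  by move=> e; rewrite !inE => /orP[]/eqP->.
have Mxy : index_matrix P x y = - index_matrix P y x.
  by rewrite /index_matrix eq_sym; case: eqVneq => // _; rewrite linkingC.
have row : \sum_(d <- x :: y :: C) index_matrix P x d =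
           - \sum_(d <- x :: y :: C) index_matrix P y d.
  rewrite !big_cons Mxy !index_matrix_diag (eq_big_seq _ Ml) sumrN.
  by rewrite !add0r opprD.
have W0 : dwrithe_of n (x :: y :: C) (index_matrix P) =
          dwrithe_of n C (index_matrix P) by exact: dwrithe_of_cancel.
(* The smoothings at [x] and at [y] agree after renaming [y] to [x]. *)
have sm e : e \in C ->
    smooth_matrix P x e y = smooth_matrix P y e x /\
    smooth_matrix P x y e = smooth_matrix P y x e.
  move=> eC; have key : smooth_matrix P x e y = smooth_matrix P y e x.
    rewrite /smooth_matrix neqx // neqy //.
    have pq : P e true != P e false by apply/eqP => /(inj e e (inC e eC) (inC e eC))[].
    have : R2_check k m (P e true) (P e false).
      apply: R2_check_transfer; move: pq (out e true eC) (out e false eC) km.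
      rewrite /= !inE !negb_or; clear.
      move=> pq [p1 p2 p3 p4] [q1 q2 q3 q4] km.
      lia.
    have ob : o \in [:: true; false] by case: (o).
    move=> /allP/(_ o ob)/eqP.
    move: Pxk Pyk Pxm Pym; rewrite /chord; case: (lx) => /= -> -> -> -> //.
    (* If [lx] fails, both chords are the opposites of those of [R2_check]. *)
    rewrite -[(_, k)]/(swap (k, _)) -[(k.+1, _)]/(swap (_, k.+1)).
    by rewrite !smooth_linking_swapc !smooth_linking_swapr => ->.
  split=> //.
  have anti2 z w : z \in x :: y :: C -> w \in x :: y :: C ->
      smooth_matrix P z e w = - smooth_matrix P z w e.
    move=> zin win; rewrite /smooth_matrix eq_sym; case: eqVneq => [|we].
      by rewrite oppr0.
    apply: smooth_linkingC.
    apply: (distinct_ends_uniq (s := [:: e; w]) inj).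
      by rewrite /= inE eq_sym we.
    by move=> v; rewrite in_cons mem_seq1 => /orP[]/eqP-> //; apply: inC.
  by apply: oppr_inj; rewrite -!anti2.
have Wxy : dwrithe_of n (y :: C) (smooth_matrix P x) =
           dwrithe_of n (x :: C) (smooth_matrix P y).
  have smC e d : e \in C -> d \in C ->
      smooth_matrix P x e d = smooth_matrix P y e d.
    move=> eC dC; rewrite /smooth_matrix; case: eqVneq => // ed.
    by rewrite (antiparallel_smooth_linkingc anti).
  rewrite /dwrithe_of !big_cons; congr (weight n _ + _).
    rewrite !smooth_matrix_diag; congr (_ + _).
    by apply: eq_big_seq => e eC; case: (sm e eC).
  apply: eq_big_seq => e eC; rewrite !big_cons; congr (weight n (_ + _)).
    by case: (sm e eC).
  by apply: eq_big_seq => d dC; apply: smC.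
(* The terms of [x] and [y] cancel. *)
rewrite /gauss_poly !big_cons addrA [X in X + _](_ : _ = 0) ?add0r; last first.
  rewrite /gauss_term row W0 /= eqxx (negPf xy) eqxx Wxy sgxy mulrNN.
  by rewrite rmorphN mulNr addNr.
apply: eq_big_seq => c cC; have [cx cy] := (neqx c cC, neqy c cC).
have rowc : \sum_(d <- x :: y :: C) index_matrix P c d =
            \sum_(d <- C) index_matrix P c d.
  by rewrite !big_cons Mr // addKr.
rewrite /gauss_term W0 rowc /= ![_ == c]eq_sym cx cy.
congr (_ * (_ * _ ^+ `|_|%N - _)); apply: dwrithe_of_cancel.
  move=> e; rewrite mem_rem_uniq // => /andP[/= ec eC].
  rewrite /smooth_matrix neqx // neqy //.
  by apply: (antiparallel_smooth_linkingr anti xC cC eC); rewrite eq_sym.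
have sl e : e \in rem c C -> smooth_matrix P c x e = - smooth_matrix P c y e.
  rewrite mem_rem_uniq // => /andP[/= ec eC].
  rewrite /smooth_matrix ![_ == e]eq_sym neqx // neqy //.
  by apply: (antiparallel_smooth_linkingl anti xC cC eC); rewrite eq_sym.
rewrite !big_cons !smooth_matrix_diag (eq_big_seq _ sl) sumrN !add0r.
rewrite opprD; congr (_ + _); rewrite /smooth_matrix eq_sym.
by case: eqVneq => // _; rewrite smooth_linkingC.
Qed.

(** * Third move on chords *)

(** The chord with ends [p] and [q], of which [p] comes from bottom left if and
    only if [l] holds. *)
Definition ends (l : bool) (p q : nat) := if l then (p, q) else (q, p).

(** What the third move does to the chord [a] of the triangle [a], [b], [c], which
    becomes [a'], [b'], [c'], in the presence of a chord [x] outside the triangle.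
    The total linking with [b] and [c] is unchanged, for [a] in the diagram and in
    its smoothing at [x], and for [x] in the smoothing at [a].  In the smoothing
    at [a], the chords [b] and [c] exchange their roles if [ex] holds, and have
    opposite linkings before and after the move otherwise. *)
Definition R3_row (ex : bool) (a b c a' b' c' x : nat * nat) : bool :=
  [&& linking ltn a b + linking ltn a c == linking ltn a' b' + linking ltn a' c',
      smooth_linking x a b + smooth_linking x a c ==
      smooth_linking x a' b' + smooth_linking x a' c',
      smooth_linking a x b + smooth_linking a x c ==
      smooth_linking a' x b' + smooth_linking a' x c' &
      if ex then
        [&& smooth_linking a b x == smooth_linking a' c' x,
            smooth_linking a c x == smooth_linking a' b' x,
            smooth_linking a b c == smooth_linking a' c' b' &
            smooth_linking a c b == smooth_linking a' b' c']
      else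
        [&& smooth_linking a b x == - smooth_linking a c x,
            smooth_linking a' b' x == - smooth_linking a' c' x,
            smooth_linking a b c == - smooth_linking a c b &
            smooth_linking a' b' c' == - smooth_linking a' c' b']].

(** The condition [triangle] in terms of the values of [lr] at [a], [b], [c]. *)
Definition triangle_lr (la lb lc o1 o2 o3 : bool) : bool :=
  [&& (la == o2) == (lb == o3), (~~ la == o1) == (lc == ~~ o3) &
      (~~ lb == ~~ o1) == (~~ lc == ~~ o2)].

(** [R3_row] at the three vertices.  Which of its two alternatives holds at a vertex
    is decided by the values of [lr] at the other two vertices. *)
Definition R3_rows (la lb lc : bool) a b c a' b' c' x : bool :=
  [&& R3_row (lb != lc) a b c a' b' c' x,
      R3_row (la == lc) b c a b' c' a' x &
      R3_row (la != lb) c a b c' a' b' x].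

(** The three strands occupy the positions [n1], [n2], [n3] and their successors,
    and the move exchanges the two passages of each strand. *)
Definition R3_check (la lb lc o1 o2 o3 : bool) n1 n2 n3 p q : bool :=
  R3_rows la lb lc
    (ends la (n1 + ~~ o1) (n2 + ~~ o2)) (ends lb (n1 + o1) (n3 + ~~ o3))
    (ends lc (n2 + o2) (n3 + o3))
    (ends la (n1 + o1) (n2 + o2)) (ends lb (n1 + ~~ o1) (n3 + o3))
    (ends lc (n2 + ~~ o2) (n3 + ~~ o3)) (p, q).

(* [if] is used below in place of [&&] and [==>], both arguments of which are
   evaluated by [vm_compute]. *)
Definition all_bool (f : bool -> bool) : bool := if f true then f false else false.

Definition all_range (f : nat -> bool) : bool := all f (iota 0 8).

(** Eight distinct endpoints have ranks from 0 to 7. *)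
Definition R3_all_checks : bool :=
  all_range (fun n1 => all_range (fun n2 => all_range (fun n3 =>
    if (if n1.+1 < n2 then n2.+1 < n3 < 7 else false)%N then
    all_range (fun p => all_range (fun q =>
    if uniq [:: n1; n1.+1; n2; n2.+1; n3; n3.+1; p; q] then
    all_bool (fun la => all_bool (fun lb => all_bool (fun lc =>
    all_bool (fun o1 => all_bool (fun o2 => all_bool (fun o3 =>
    if triangle_lr la lb lc o1 o2 o3 then R3_check la lb lc o1 o2 o3 n1 n2 n3 p q
    else true)))))) else true)) else true))).

Lemma R3_checked : R3_all_checks.
Proof. by vm_compute. Qed.

Lemma all_boolP (f : bool -> bool) : all_bool f -> forall b, f b.
Proof. by rewrite /all_bool; case: ifP => // ft ff []. Qed.

Lemma R3_row_mono f (L : seq nat) ex a b c a' b' c' x :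
  {in L &, forall x y, (f x < f y)%N = (x < y)%N} ->
  all (fun e => (e.1 \in L) && (e.2 \in L)) [:: a; b; c; a'; b'; c'; x] ->
  R3_row ex (map_chord f a) (map_chord f b) (map_chord f c) (map_chord f a')
    (map_chord f b') (map_chord f c') (map_chord f x) =
  R3_row ex a b c a' b' c' x.
Proof.
move=> fL /allP sL.
have lin e d : e \in [:: a; b; c; a'; b'; c'; x] ->
    d \in [:: a; b; c; a'; b'; c'; x] ->
    linking ltn (map_chord f e) (map_chord f d) = linking ltn e d.
  move=> /sL/andP[e1 e2] /sL/andP[d1 d2]; apply: linking_mono fL _.
  by apply/allP; rewrite /= e1 e2 d1 d2.
have smo g e d : g \in [:: a; b; c; a'; b'; c'; x] ->
    e \in [:: a; b; c; a'; b'; c'; x] -> d \in [:: a; b; c; a'; b'; c'; x] ->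
    smooth_linking (map_chord f g) (map_chord f e) (map_chord f d) =
    smooth_linking g e d.
  move=> /sL/andP[g1 g2] /sL/andP[e1 e2] /sL/andP[d1 d2].
  by apply: smooth_linking_mono fL _; apply/allP; rewrite /= g1 g2 e1 e2 d1 d2.
by rewrite /R3_row !lin ?smo // !inE !eqxx ?orbT.
Qed.

Lemma R3_check_transfer la lb lc o1 o2 o3 n1 n2 n3 p q :
  triangle_lr la lb lc o1 o2 o3 -> (n1.+1 < n2)%N -> (n2.+1 < n3)%N ->
  uniq [:: n1; n1.+1; n2; n2.+1; n3; n3.+1; p; q] ->
  R3_check la lb lc o1 o2 o3 n1 n2 n3 p q.
Proof.
move=> tri n12 n23; set L := [:: _; _; _; _; _; _; _; _] => uL.
pose f := rank L.
have fL : {in L &, forall x y, (f x < f y)%N = (x < y)%N} := rank_lt uL.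
have [n1L n1L' n2L n2L'] :
    [/\ n1 \in L, n1.+1 \in L, n2 \in L & n2.+1 \in L].
  by rewrite !inE !eqxx !orbT.
have [n3L n3L' pL qL] : [/\ n3 \in L, n3.+1 \in L, p \in L & q \in L].
  by rewrite !inE !eqxx !orbT.
have fS x : x \in L -> f x.+1 = (f x).+1 by apply: rankS.
have f8 x : x \in L -> f x \in iota 0 8 by apply: rank_iota.
have finj : {in L &, injective f} := rank_inj uL.
have uf : uniq [:: f n1; (f n1).+1; f n2; (f n2).+1; f n3; (f n3).+1; f p; f q].
  by rewrite -!fS //; rewrite -[X in uniq X]/(map f L) map_inj_in_uniq.
have fn12 : ((f n1).+1 < f n2)%N by rewrite -fS // fL.
have fn23 : ((f n2).+1 < f n3)%N by rewrite -fS // fL.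
have fn3 : (f n3 < 7)%N.
  by rewrite -ltnS -fS //; move: (f8 _ n3L'); rewrite mem_iota.
have := R3_checked; rewrite /R3_all_checks.
move=> /allP/(_ _ (f8 _ n1L)) /allP/(_ _ (f8 _ n2L)) /allP/(_ _ (f8 _ n3L)).
rewrite fn12 fn23 fn3 => /allP/(_ _ (f8 _ pL)) /allP/(_ _ (f8 _ qL)).
rewrite uf => /all_boolP/(_ la)/all_boolP/(_ lb)/all_boolP/(_ lc).
move=> /all_boolP/(_ o1)/all_boolP/(_ o2)/all_boolP/(_ o3).
rewrite tri /R3_check /R3_rows.
have fb n (b : bool) : n \in L -> (f n + b = f (n + b))%N.
  by move=> nL; case: b => /=; rewrite ?addn0 // !addn1 fS.
rewrite !fb //.
have fe l n m : ends l (f n) (f m) = map_chord f (ends l n m) by case: l.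
rewrite !fe -[(f p, f q)]/(map_chord f (p, q)).
have L1 (b : bool) : (n1 + b)%N \in L by case: b => /=; rewrite ?addn0 ?addn1.
have L2 (b : bool) : (n2 + b)%N \in L by case: b => /=; rewrite ?addn0 ?addn1.
have L3 (b : bool) : (n3 + b)%N \in L by case: b => /=; rewrite ?addn0 ?addn1.
have eL l n m : n \in L -> m \in L ->
    ((ends l n m).1 \in L) && ((ends l n m).2 \in L).
  by case: l => /= -> ->.
by rewrite !(R3_row_mono _ fL) //= !eL // pL qL.
Qed.

(** If [A] and [A'] differ only on a triple, they have the same sums over rows as
    soon as this holds for the rows of the triple. *)
Lemma row_sums_triple (A A' : nat -> nat -> int) a b c S :
  (forall e, A e e = 0) -> (forall e, A' e e = 0) ->
  {in S &, forall e d, A e d = A' e d} ->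
  {in [:: a; b; c] & S, forall t d, A t d = A' t d /\ A d t = A' d t} ->
  A a b + A a c = A' a b + A' a c ->
  A b c + A b a = A' b c + A' b a ->
  A c a + A c b = A' c a + A' c b ->
  {in a :: b :: c :: S, forall e,
    \sum_(d <- a :: b :: c :: S) A e d = \sum_(d <- a :: b :: c :: S) A' e d}.
Proof.
move=> A0 A0' AS AT Aa Ab Ac e.
have tin t : t \in [:: a; b; c] ->
    \sum_(d <- S) A t d = \sum_(d <- S) A' t d.
  by move=> tabc; apply: eq_big_seq => d dS; case: (AT t d tabc dS).
have [ain bin cin] : [/\ a \in [:: a; b; c], b \in [:: a; b; c] & c \in [:: a; b; c]].
  by rewrite !inE !eqxx !orbT.
rewrite !in_cons => /or4P[/eqP->|/eqP->|/eqP->|eS]; rewrite !big_cons.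
- by rewrite A0 A0' tin // !add0r !addrA Aa.
- by rewrite A0 A0' tin // !add0r !addrA (addrC (A b a)) (addrC (A' b a)) Ab.
- by rewrite A0 A0' tin // !add0r !addrA Ac.
rewrite (proj2 (AT a e ain eS)) (proj2 (AT b e bin eS)) (proj2 (AT c e cin eS)).
by do 3 congr (_ + _); apply: eq_big_seq => d dS; apply: AS.
Qed.

(** The pair [b], [c] has the same contribution for [A] and [A'], either because
    [b] and [c] are exchanged, or because it vanishes in both cases. *)
Lemma dwrithe_of_pair n (A A' : nat -> nat -> int) b c S (ex : bool) :
  (forall e, A e e = 0) -> (forall e, A' e e = 0) ->
  {in S &, forall e d, A e d = A' e d} ->
  {in S, forall e, A e b + A e c = A' e b + A' e c} ->
  (if ex then
     [/\ {in S, A b =1 A' c}, {in S, A c =1 A' b}, A b c = A' c b & A c b = A' b c]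
   else
     [/\ {in S, forall x, A b x = - A c x}, {in S, forall x, A' b x = - A' c x},
         A b c = - A c b & A' b c = - A' c b]) ->
  dwrithe_of n (b :: c :: S) A = dwrithe_of n (b :: c :: S) A'.
Proof.
move=> A0 A0' AS Abc Hex.
have sum2 (F : nat -> int) :
    \sum_(e <- b :: c :: S) F e = F b + F c + \sum_(e <- S) F e.
  by rewrite !big_cons addrA.
rewrite /dwrithe_of [LHS]sum2 [RHS]sum2; congr (_ + _); last first.
  apply: eq_big_seq => e eS; congr weight; rewrite !sum2 Abc //.
  by congr (_ + _); apply: eq_big_seq => d dS; apply: AS.
rewrite !sum2 !A0 !A0' !add0r !addr0.
case: ex Hex => [[Ab Ac -> ->] | [Ab Ac -> ->]].
  by rewrite (eq_big_seq _ Ab) (eq_big_seq _ Ac) addrC.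
by rewrite (eq_big_seq _ Ab) (eq_big_seq _ Ac) !sumrN -!opprD !weightN !addNr.
Qed.

(** [R3_row] for all the chords of [S], and for at least one [x] so that the
    clauses in which [x] does not occur are available when [S] is empty. *)
Definition R3_at (P P' : nat -> bool -> nat) (S : seq nat) a b c : Prop :=
  exists ex : bool,
    (exists x, R3_row ex (chord P a) (chord P b) (chord P c)
                 (chord P' a) (chord P' b) (chord P' c) x) /\
    {in S, forall x, R3_row ex (chord P a) (chord P b) (chord P c)
                 (chord P' a) (chord P' b) (chord P' c) (chord P x)}.

Lemma same_order_sub (s s' : seq nat) P P' : {subset s <= s'} ->
  same_order s' P P' -> same_order s P P'.
Proof. by move=> sub ord e d es ds; apply: ord; apply: sub. Qed.

Section Triple.
Variables (P P' : nat -> bool -> nat) (S : seq nat).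

Lemma R3_at_index a b c : b != a -> c != a -> R3_at P P' S a b c ->
  index_matrix P a b + index_matrix P a c =
  index_matrix P' a b + index_matrix P' a c.
Proof.
move=> ba ca [ex [[x /and4P[/eqP E _ _ _]] _]].
by rewrite /index_matrix !(eq_sym a) (negPf ba) (negPf ca).
Qed.

Hypothesis PP' : {in S, forall e b, P e b = P' e b}.

Let chS x : x \in S -> chord P x = chord P' x.
Proof. by move=> xS; rewrite /chord !PP'. Qed.

Lemma R3_at_smooth a b c x : x \in S -> b != a -> c != a ->
  R3_at P P' S a b c ->
  smooth_matrix P x a b + smooth_matrix P x a c =
  smooth_matrix P' x a b + smooth_matrix P' x a c.
Proof.
move=> xS ba ca [ex [_ /(_ x xS) /and4P[_ /eqP E _ _]]].
by rewrite /smooth_matrix !(eq_sym a) (negPf ba) (negPf ca) -(chS xS).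
Qed.

Lemma R3_at_dwrithe n a b c : uniq (b :: c :: S) -> a \notin S ->
  same_order (a :: S) P P' -> R3_at P P' S a b c ->
  dwrithe_of n (b :: c :: S) (smooth_matrix P a) =
  dwrithe_of n (b :: c :: S) (smooth_matrix P' a).
Proof.
move=> /and3P[]; rewrite in_cons negb_or => /andP[bc bS] cS uS aS ord.
case=> ex [[x0 row0] row].
have ne t x : t \notin S -> x \in S -> (t == x) = false.
  by move=> tS xS; apply: contraNF tS => /eqP->.
have ne' t x : t \notin S -> x \in S -> (x == t) = false.
  by move=> tS xS; rewrite eq_sym ne.
apply: (@dwrithe_of_pair _ _ _ _ _ _ ex) => [e|e|e d eS dS|e eS|].
- exact: smooth_matrix_diag.
- exact: smooth_matrix_diag.
- rewrite /smooth_matrix; case: eqVneq => // ed.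
  apply: smooth_linking_ext; first by rewrite /= !inE negb_or ed !ne.
  move=> u v; rewrite !inE => uS' vS'; apply: ord; rewrite in_cons.
    by case/or3P: uS' => /eqP->; rewrite ?eqxx ?eS ?dS ?orbT.
  by case/or3P: vS' => /eqP->; rewrite ?eqxx ?eS ?dS ?orbT.
- have /and4P[_ _ /eqP E _] := row e eS.
  by rewrite /smooth_matrix !ne' // -(chS eS).
case: ex row0 row => /and4P[_ _ _ /and4P[_ _ /eqP r1 /eqP r2]] row;
  split; rewrite /smooth_matrix ?(eq_sym c) ?(negPf bc) //.
- move=> x xS; rewrite !ne // -(chS xS).
  by have /and4P[_ _ _ /and4P[/eqP]] := row x xS.
- move=> x xS; rewrite !ne // -(chS xS).
  by have /and4P[_ _ _ /and4P[_ /eqP]] := row x xS.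
- by move=> x xS; rewrite !ne //; have /and4P[_ _ _ /and4P[/eqP]] := row x xS.
- move=> x xS; rewrite !ne // -(chS xS).
  by have /and4P[_ _ _ /and4P[_ /eqP]] := row x xS.
Qed.

Lemma gauss_poly_triple n sg a b c : uniq (a :: b :: c :: S) ->
  {in [:: a; b; c], forall t, same_order (t :: S) P P'} ->
  R3_at P P' S a b c -> R3_at P P' S b c a -> R3_at P P' S c a b ->
  gauss_poly n (a :: b :: c :: S) sg P = gauss_poly n (a :: b :: c :: S) sg P'.
Proof.
move=> uC ord Ha Hb Hc.
have := uC; rewrite /= !inE !negb_or => /and4P[/and3P[ab ac aS] /andP[bc bS] cS uS].
have tS t : t \in [:: a; b; c] -> t \notin S.
  by rewrite !inE => /or3P[]/eqP->.
have ordS : same_order S P P'.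
  by move=> e d eS dS b1 b2 _; rewrite !PP'.
have neS t x : t \in [:: a; b; c] -> x \in S -> t != x.
  by move=> /tS tS' xS; apply: contraNneq tS' => ->.
apply: gauss_poly_ext => // z.
  apply: row_sums_triple => [e|e|e d eS dS|t d tabc dS|||].
  - exact: index_matrix_diag.
  - exact: index_matrix_diag.
  - by rewrite /index_matrix !chS.
  - have td := neS t d tabc dS; rewrite /index_matrix (eq_sym d) (negPf td).
    by split; apply: linking_ext; rewrite 1?(eq_sym d) //;
      apply: same_order_sub (ord t tabc) => u; rewrite !inE => /orP[]/eqP->;
      rewrite ?eqxx ?dS ?orbT.
  - by apply: R3_at_index => //; rewrite eq_sym.
  - by apply: R3_at_index => //; rewrite eq_sym.
  - by apply: R3_at_index => //; rewrite eq_sym.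
have [oa ob oc] : [/\ same_order (a :: S) P P', same_order (b :: S) P P' &
                      same_order (c :: S) P P'].
  by split; apply: ord; rewrite !inE eqxx ?orbT.
rewrite !in_cons => /or4P[/eqP->|/eqP->|/eqP->|zS]; congr absz.
- rewrite /= eqxx; apply: R3_at_dwrithe => //.
  by rewrite /= in_cons negb_or bc bS cS uS.
- rewrite /= (negPf ab) eqxx.
  rewrite !(@dwrithe_of_perm _ (a :: c :: S) (c :: a :: S)); last first.
  + by rewrite (perm_catCA [:: a] [:: c]).
  + by rewrite (perm_catCA [:: a] [:: c]).
  apply: R3_at_dwrithe => //.
  by rewrite /= in_cons negb_or eq_sym ac cS aS uS.
- rewrite /= (negPf ac) (negPf bc) eqxx.
  apply: R3_at_dwrithe => //.
  by rewrite /= in_cons negb_or ab bS aS uS.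
have [za zb zc] : [/\ (a == z) = false, (b == z) = false & (c == z) = false].
  by split; apply/negbTE; apply: neS; rewrite ?inE ?eqxx ?orbT.
rewrite /= za zb zc; apply: eq_big_seq => e eC; congr weight; move: e eC.
have memz e : e \in rem z S -> e != z /\ e \in S.
  by rewrite mem_rem_uniq // => /andP[].
apply: row_sums_triple => [e|e|e d /memz[ez eS] /memz[dz dS]|t d tabc /memz[dz dS]|||].
- exact: smooth_matrix_diag.
- exact: smooth_matrix_diag.
- by rewrite /smooth_matrix !chS.
- have td := neS t d tabc dS; have tz := neS t z tabc zS.
  rewrite /smooth_matrix (eq_sym d) (negPf td).
  by split; apply: smooth_linking_ext;
    rewrite /= ?inE ?negb_or ?(eq_sym z) ?tz ?dz ?(eq_sym d) ?td //;
    apply: same_order_sub (ord t tabc) => u; rewrite !inE => /or3P[]/eqP->;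
    rewrite ?eqxx ?dS ?zS ?orbT.
- by apply: R3_at_smooth => //; rewrite eq_sym.
- by apply: R3_at_smooth => //; rewrite eq_sym.
- by apply: R3_at_smooth => //; rewrite eq_sym.
Qed.
End Triple.

Lemma gauss_poly_R3 n sg P P' S a b c la lb lc o1 o2 o3 n1 n2 n3 :
  uniq (a :: b :: c :: S) -> distinct_ends (a :: b :: c :: S) P ->
  {in S, forall e b, P e b = P' e b} ->
  (P a la = n1 + ~~ o1)%N -> (P b lb = n1 + o1)%N ->
  (P a (~~ la) = n2 + ~~ o2)%N -> (P c lc = n2 + o2)%N ->
  (P b (~~ lb) = n3 + ~~ o3)%N -> (P c (~~ lc) = n3 + o3)%N ->
  (P' a la = n1 + o1)%N -> (P' b lb = n1 + ~~ o1)%N ->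
  (P' a (~~ la) = n2 + o2)%N -> (P' c lc = n2 + ~~ o2)%N ->
  (P' b (~~ lb) = n3 + o3)%N -> (P' c (~~ lc) = n3 + ~~ o3)%N ->
  (n1.+1 < n2)%N -> (n2.+1 < n3)%N -> triangle_lr la lb lc o1 o2 o3 ->
  gauss_poly n (a :: b :: c :: S) sg P = gauss_poly n (a :: b :: c :: S) sg P'.
Proof.
move=> uC inj PP' a1 b1 a2 c2 b3 c3 a1' b1' a2' c2' b3' c3' n12 n23 tri.
have := uC; rewrite /= !inE !negb_or => /and4P[/and3P[ab ac aS] /andP[bc bS] cS uS].
(* The triangle occupies the six positions on the three strands. *)
have out e x : e \in S ->
    [/\ P e x != n1, P e x != n1.+1, P e x != n2 & P e x != n2.+1] /\
    (P e x != n3) && (P e x != n3.+1).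
  move=> eS; have ne t y : t \in [:: a; b; c] -> P e x != P t y.
    move=> tabc; apply/eqP => E.
    have [] := inj e t _ _ x y E.
    - by rewrite !in_cons eS !orbT.
    - by move: tabc; rewrite !inE => /or3P[]/eqP->; rewrite eqxx ?orbT.
    move=> et; move: tabc aS bS cS; rewrite -et !inE.
    by case/or3P=> /eqP<-; rewrite eS.
  have [ain bin cin] :
      [/\ a \in [:: a; b; c], b \in [:: a; b; c] & c \in [:: a; b; c]].
    by rewrite !inE !eqxx !orbT.
  move: (ne a la ain) (ne a (~~ la) ain) (ne b lb bin) (ne b (~~ lb) bin)
    (ne c lc cin) (ne c (~~ lc) cin); rewrite a1 b1 a2 c2 b3 c3.
  by case: (o1) (o2) (o3) => [] [] [] /=; rewrite !addn0 !addn1 => -> -> -> -> -> ->.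
have ord t : t \in [:: a; b; c] -> same_order (t :: S) P P'.
  move=> tabc.
  have cmp e x y : e \in S -> (P e x < P t y)%N = (P' e x < P' t y)%N /\
                              (P t y < P e x)%N = (P' t y < P' e x)%N.
    move=> eS; rewrite -PP' //; have [[m1 m1' m2 m2'] /andP[m3 m3']] := out e x eS.
    have near k (o o' : bool) : P e x != k -> P e x != k.+1 ->
        (P e x < k + o)%N = (P e x < k + o')%N /\ (k + o < P e x)%N = (k + o' < P e x)%N.
      by clear; case: o o' => [] []; lia.
    move: tabc; rewrite !inE => /or3P[]/eqP->.
    - have [->|->] : y = la \/ y = ~~ la by case: (y) (la) => [] []; auto.
        by rewrite a1 a1'; apply: near.
      by rewrite a2 a2'; apply: near.
    - have [->|->] : y = lb \/ y = ~~ lb by case: (y) (lb) => [] []; auto.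
        by rewrite b1 b1'; apply: near.
      by rewrite b3 b3'; apply: near.
    - have [->|->] : y = lc \/ y = ~~ lc by case: (y) (lc) => [] []; auto.
        by rewrite c2 c2'; apply: near.
      by rewrite c3 c3'; apply: near.
  move=> e d; rewrite !in_cons => /orP[/eqP->|eS] /orP[/eqP->|dS] x y ed.
  - by rewrite eqxx in ed.
  - by case: (cmp d y x dS).
  - by case: (cmp e x y eS).
  - by rewrite !PP'.
have chE Q t l p q : Q t l = p -> Q t (~~ l) = q -> chord Q t = ends l p q.
  by rewrite /chord; case: l => /= -> ->.
have chk p q : uniq [:: n1; n1.+1; n2; n2.+1; n3; n3.+1; p; q] ->
    R3_rows la lb lc (chord P a) (chord P b) (chord P c)
      (chord P' a) (chord P' b) (chord P' c) (p, q).
  move/(R3_check_transfer tri n12 n23).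
  by rewrite /R3_check -(chE _ _ _ _ _ a1 a2) -(chE _ _ _ _ _ b1 b3)
    -(chE _ _ _ _ _ c2 c3) -(chE _ _ _ _ _ a1' a2') -(chE _ _ _ _ _ b1' b3')
    -(chE _ _ _ _ _ c2' c3').
(* Fictitious ends beyond the third strand, for the clauses without [x]. *)
have chk0 : R3_rows la lb lc (chord P a) (chord P b) (chord P c)
    (chord P' a) (chord P' b) (chord P' c) (n3.+2, n3.+3).
  apply: chk; apply: (sorted_uniq ltn_trans ltnn).
  by rewrite /= n12 n23 !ltnS !leqnn.
have {}chk x : x \in S ->
    R3_rows la lb lc (chord P a) (chord P b) (chord P c)
      (chord P' a) (chord P' b) (chord P' c) (chord P x).
  move=> xS; apply: chk.
  have xC : x \in [:: a, b, c & S] by rewrite !in_cons xS !orbT.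
  have pq : P x true != P x false by apply/eqP => /(inj x x xC xC)[].
  have [[p1 p2 p3 p4] /andP[p5 p6]] := out x true xS.
  have [[q1 q2 q3 q4] /andP[q5 q6]] := out x false xS.
  rewrite /= !inE; clear - n12 n23 pq p1 p2 p3 p4 p5 p6 q1 q2 q3 q4 q5 q6.
  lia.
apply: gauss_poly_triple => //.
- exists (lb != lc); split; last by move=> x /chk/and3P[].
  by exists (n3.+2, n3.+3); case/and3P: chk0.
- exists (la == lc); split; last by move=> x /chk/and3P[].
  by exists (n3.+2, n3.+3); case/and3P: chk0.
- exists (la != lb); split; last by move=> x /chk/and3P[].
  by exists (n3.+2, n3.+3); case/and3P: chk0.
Qed.

(** * Passages and crossings of a word *)
Lemma mateK : involutive mate.
Proof. by case=> c [] []. Qed.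

Lemma mate_neq v : mate v != v.
Proof. by case: v => c k b; apply/eqP => -[_]; case: b. Qed.

Lemma classical_mate v : classical (mate v) = classical v.
Proof. by case: v => c [] b. Qed.

Lemma over_mate v : classical v -> over (mate v) = ~~ over v.
Proof. by case: v => c [] b. Qed.

Lemma over_classical v : over v -> classical v.
Proof. by case: v => c [] b. Qed.

Lemma matched_uniq w : matched w -> uniq w.
Proof. by case/andP. Qed.

Lemma matched_mate w v : matched w -> (mate v \in w) = (v \in w).
Proof.
case/andP=> _ /allP wm; apply/idP/idP => /wm/andP[] //.
by rewrite mateK.
Qed.

(** The two passages through a double point are the only ones with its name. *)
Lemma matched_name w u v : matched w -> u \in w -> v \in w ->
  name u = name v -> u = v \/ u = mate v.
Proof.
move=> wm uw vw uv; have [_ /allP/(_ v vw)/andP[mw /eqP count2]] := andP wm.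
have [-> | nv] := eqVneq u v; first by left.
have [-> | nm] := eqVneq u (mate v); first by right.
suff: (size [:: u; v; mate v] <= 2)%N by [].
rewrite -count2 -size_filter; apply: uniq_leq_size.
  by rewrite /= !inE negb_or nv nm eq_sym mate_neq.
move=> t; rewrite !inE mem_filter => /or3P[]/eqP->; first by rewrite uv eqxx.
  by rewrite eqxx.
by rewrite eqxx.
Qed.

Lemma matched_lr w u v : matched w -> u \in w -> v \in w ->
  name u = name v -> lr u = lr v -> u = v.
Proof.
move=> wm uw vw uv; case: (matched_name wm uw vw uv) => // ->.
by rewrite /=; case: (lr v).
Qed.

Lemma pos_index D v : matched (word D) -> v \in word D ->
  pos D (name v) (lr v) = index v (word D).
Proof.
move=> wm vw; apply: eq_in_find => u uw /=; apply/andP/eqP => [[]|->] //.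
by move=> /eqP uv /eqP; apply: matched_lr uw vw uv.
Qed.

Lemma crossingP D c b : matched (word D) -> c \in crossings D ->
  exists v, [/\ v \in word D, classical v, name v = c & lr v = b].
Proof.
move=> wm /mapP[v]; rewrite mem_filter => /andP[ov vw] ->.
have cv := over_classical ov.
have [vb | vb] := eqVneq (lr v) b; first by exists v.
exists (mate v); rewrite matched_mate // classical_mate; split=> //=.
by case: (lr v) b vb => [] [].
Qed.

Lemma uniq_crossings D : matched (word D) -> uniq (crossings D).
Proof.
move=> wm; rewrite map_inj_in_uniq ?filter_uniq ?matched_uniq // => u v.
rewrite !mem_filter => /andP[ou uw] /andP[ov vw] uv.
case: (matched_name wm uw vw uv) => // E.
by move: ou; rewrite E over_mate ?ov ?over_classical.
Qed.

Lemma pos_distinct D : matched (word D) -> distinct_ends (crossings D) (pos D).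
Proof.
move=> wm e d eC dC b b'.
have [u [uw _ <- <-]] := crossingP b wm eC.
have [v [vw _ <- <-]] := crossingP b' wm dC.
by rewrite !pos_index // => /index_inj ->.
Qed.

Lemma pos_lt_size D c b : matched (word D) -> c \in crossings D ->
  (pos D c b < size (word D))%N.
Proof.
move=> wm cC; have [u [uw _ <- <-]] := crossingP b wm cC.
by rewrite pos_index // index_mem.
Qed.

Lemma sgnE D v : matched (word D) -> v \in word D -> classical v ->
  sgn D (name v) = if over v == lr v then 1 else -1.
Proof.
move=> wm vw cv; rewrite /sgn; congr (if _ then _ else _).
apply/idP/eqP => [ow | olr].
  case: (matched_name wm ow vw _) => // E.
    by rewrite -E.
  have -> : v = mate (Passage (name v) Over true) by rewrite E mateK.
  by [].
by case: v vw cv olr => c [] [] //= vw _ _; rewrite -(matched_mate _ wm).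
Qed.

Lemma perm_mate w : matched w -> perm_eq w (map mate w).
Proof.
move=> wm; apply: uniq_perm; first exact: matched_uniq.
  by rewrite (map_inj_uniq (can_inj mateK)) matched_uniq.
move=> v; apply/idP/mapP => [vw | [u uw ->]]; last by rewrite matched_mate.
by exists (mate v); rewrite ?mateK ?matched_mate.
Qed.

Lemma sum_over_mate (V : nmodType) w (F : passage -> V) : matched w ->
  (forall v, virtual v -> F v = 0) ->
  \sum_(v <- w) F v = \sum_(v <- w | over v) (F v + F (mate v)).
Proof.
move=> wm F0; rewrite (bigID over) big_split /=; congr (_ + _).
rewrite (perm_big _ (perm_mate wm)) big_map /= [LHS](bigID classical) /=.
rewrite [X in _ + X]big1 ?addr0 => [|v /andP[_ vv]]; last first.
  by apply: F0; move: vv; case: (v) => c [] b.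
by apply: eq_bigl => v; case: v => c [] b.
Qed.

Lemma sum_crossings (V : nmodType) D (G : nat -> V) :
  \sum_(c <- crossings D) G c = \sum_(v <- word D | over v) G (name v).
Proof. by rewrite big_map big_filter. Qed.

Lemma sum_take (V : nmodType) (T : eqType) (w : seq T) k (F : T -> V) : uniq w ->
  \sum_(v <- take k w) F v = \sum_(v <- w | (index v w < k)%N) F v.
Proof.
elim: w k => [|x w IHw] [|k] /= => [|||/andP[xw uw]]; rewrite ?big_nil //.
  by move=> _; rewrite big_pred0.
rewrite !big_cons /= eqxx /= IHw //; congr (_ + _).
rewrite [LHS]big_seq_cond [RHS]big_seq_cond; apply: eq_bigl => v.
by case: (boolP (v \in w)) => //= vw; rewrite (negPf (memPnC xw v vw)).
Qed.

(** * Index and dwrithe as linking numbers *)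
Lemma label_crossings D k : matched (word D) ->
  label D k = \sum_(c <- crossings D)
    ((pos D c false < k)%N%:Z - (pos D c true < k)%N%:Z).
Proof.
move=> wm; rewrite /label sum_take ?matched_uniq // big_mkcond.
rewrite (sum_over_mate wm) => [|v vv]; last by rewrite /jump vv; case: ifP.
rewrite sum_crossings big_seq_cond [RHS]big_seq_cond.
apply: eq_bigr => v /andP[vw ov]; have mw : mate v \in word D by rewrite matched_mate.
have := pos_index wm mw; have := pos_index wm vw.
move: (over_classical ov); rewrite /classical /jump /virtual => /negbTE.
case: v ov {vw mw} => c [] [] //= _ _ -> ->.
  by do 2 case: (_ < k)%N.
by do 2 case: (_ < k)%N.
Qed.

Lemma Ind_crossings D c : matched (word D) -> c \in crossings D ->
  Ind D c = sgn D c * \sum_(d <- crossings D) index_matrix (pos D) c d.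
Proof.
move=> wm cC; rewrite /Ind /index_from; congr (_ * _).
rewrite !label_crossings // -sumrB.
have uC := uniq_crossings wm.
rewrite (bigD1_seq c) //= [RHS](bigD1_seq c) //= index_matrix_diag add0r.
have ne : pos D c true != pos D c false.
  by apply/eqP => /(pos_distinct wm cC cC)[].
rewrite addrAC [X in X + _](_ : _ = 0) ?add0r; last first.
  by rewrite !ltnn; case: ltngtP ne.
apply: eq_bigr => d dc; rewrite /index_matrix eq_sym (negPf dc) /linking /=.
ring.
Qed.

Lemma sgn_pm D c : sgn D c = 1 \/ sgn D c = -1.
Proof. by rewrite /sgn; case: ifP; auto. Qed.

(** With F = sgn * Ind, a crossing of sign s contributes s[sF = n] - s[sF = -n],
    which is [F = n] - [F = -n] for both signs. *)
Lemma dwrithe_crossings n D : matched (word D) ->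
  dwrithe n D = dwrithe_of n (crossings D) (index_matrix (pos D)).
Proof.
move=> wm; rewrite /dwrithe /dwrithe_of /writhe.
rewrite big_mkcond [X in _ - X]big_mkcond -sumrB /=.
apply: eq_big_seq => c cC; rewrite Ind_crossings //.
case: (sgn_pm D c) => ->; rewrite ?mul1r ?mulN1r /weight.
  by do 2 case: (_ == _).
by rewrite eqr_oppLR eqr_opp; do 2 case: (_ == _).
Qed.

(** * Smoothing *)
Lemma matched_filter (p : pred passage) w : matched w ->
  {in w &, forall s t, name s = name t -> p s = p t} -> matched (filter p w).
Proof.
move=> wm pn; rewrite /matched filter_uniq ?matched_uniq //=.
apply/allP=> t; rewrite mem_filter => /andP[pt tw].
have [_ /allP/(_ t tw)/andP[mw /eqP count2]] := andP wm.
rewrite mem_filter mw (pn (mate t) t) // pt count_filter -count2.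
apply/eqP/eq_in_count => u uw /=; case: eqP => //= ut.
by rewrite (pn u t).
Qed.

Lemma matched_perm w w' : perm_eq w w' -> matched w -> matched w'.
Proof.
move=> ww' /andP[uw /allP wm]; apply/andP; split; first by rewrite -(perm_uniq ww').
apply/allP=> t; rewrite -!(perm_mem ww') => /wm.
by rewrite (permP ww').
Qed.

Lemma matched_map f w : injective f -> (forall t, name (f t) = name t) ->
  (forall t, mate (f t) = f (mate t)) -> matched w -> matched (map f w).
Proof.
move=> fI fn fm /andP[uw /allP wm]; apply/andP; split; first by rewrite map_inj_uniq.
apply/allP=> _ /mapP[t tw ->]; have /andP[mw /eqP c2] := wm t tw.
rewrite fm map_f //= count_map -c2; apply/eqP/eq_count => u /=.
by rewrite !fn.
Qed.

(** The passage [t] after reversal of the part [v] of the word: [lr] changes if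
    exactly one of the two passages through the double point lies in [v]. *)
Definition flip_ends (v : seq passage) (t : passage) : passage :=
  if count (fun t' => name t' == name t) v == 1%N
  then Passage (name t) (kind t) (~~ lr t) else t.

Section Flip.
Variable v : seq passage.

Lemma name_flip t : name (flip_ends v t) = name t.
Proof. by rewrite /flip_ends; case: ifP. Qed.

Lemma kind_flip t : kind (flip_ends v t) = kind t.
Proof. by rewrite /flip_ends; case: ifP. Qed.

Lemma mate_flip t : mate (flip_ends v t) = flip_ends v (mate t).
Proof. by rewrite /flip_ends /=; case: ifP. Qed.

Lemma flipK : involutive (flip_ends v).
Proof.
move=> t; rewrite {1}/flip_ends name_flip kind_flip /flip_ends.
by case: ifP => ->; rewrite ?negbK; case: t.
Qed.
End Flip.

Lemma index_rev (T : eqType) (s : seq T) x : uniq s -> x \in s ->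
  index x (rev s) = (size s - (index x s).+1)%N.
Proof.
move=> us xs; have lt := xs; rewrite -index_mem in lt.
set i := (size s - _)%N; have lt_i : (i < size s)%N by rewrite /i; lia.
have E : nth x (rev s) i = x.
  rewrite nth_rev // (_ : size s - i.+1 = index x s)%N ?nth_index //.
  by rewrite /i; lia.
by rewrite -{1}E index_uniq ?rev_uniq ?size_rev.
Qed.

Lemma index_rev_lt (T : eqType) (s : seq T) x y : uniq s -> x \in s -> y \in s ->
  (index x (rev s) < index y (rev s))%N = (index y s < index x s)%N.
Proof.
move=> us xs ys; rewrite !index_rev //.
by move: xs ys; rewrite -!index_mem; lia.
Qed.

Section Word.
Variables (u v z : seq passage) (x y : passage).
Let w := u ++ x :: v ++ y :: z.
Let w0 := u ++ rev v ++ z.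
Hypothesis uw : uniq w.

Let disjoint_w : [/\ x != y, x \notin u ++ v ++ z, y \notin u ++ v ++ z,
  {in u, forall s, s \notin v ++ z} & {in v, forall s, s \notin z}].
Proof.
have: uniq (x :: y :: u ++ v ++ z).
  rewrite -(@perm_uniq _ w) //; apply/permP=> a.
  by rewrite /w /= !count_cat /= count_cat /=; lia.
rewrite /= in_cons negb_or !cat_uniq => /and5P[/andP[xy xw] yw _ huv].
case/and3P=> _ hvz _; split=> // s sin; apply: contraL sin => sin.
  exact: (hasPn huv).
exact: (hasPn hvz).
Qed.

Let index_w s : s \in w0 ->
  [|| [&& s \notin v, index s w == index s u, index s w0 == index s u &
          index s u < size u],
      [&& s \in v, index s w == size u + (index s v).+1,
          index s w0 == size u + (size v - (index s v).+1) &
          index s v < size v] |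
      [&& s \notin v, index s w == size u + (size v + (index s z).+2) &
          index s w0 == size u + (size v + index s z)]]%N.
Proof.
case: disjoint_w => xy xw yw uvz vz sw.
have sw' : s \in u ++ v ++ z by move: sw; rewrite !mem_cat mem_rev.
have xs : (x == s) = false by apply: contraNF xw => /eqP->.
have ys : (y == s) = false by apply: contraNF yw => /eqP->.
have uv : uniq v by move: uw; rewrite /w cat_uniq /= cat_uniq => /and5P[_ _ _ ->].
rewrite /w /w0 !index_cat mem_rev /= xs index_cat /= ys.
have [su | su] := boolP (s \in u).
  by have := uvz s su; rewrite mem_cat negb_or => /andP[-> _]; rewrite !eqxx index_mem su.
move: sw'; rewrite !mem_cat (negPf su) /=.
have [sv _ | sv /= sz] := boolP (s \in v); rewrite ?orbT /=.
  by rewrite index_rev // index_mem sv !eqxx.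
by rewrite size_rev !addnS !eqxx !orbT.
Qed.

Let index_x : index x w = size u.
Proof.
case: disjoint_w => _ + _ _ _; rewrite /w index_cat mem_cat negb_or.
by case/andP=> /negPf-> _ /=; rewrite eqxx addn0.
Qed.

Let index_y : index y w = (size u + (size v).+1)%N.
Proof.
case: disjoint_w => xy _ + _ _; rewrite /w !mem_cat !negb_or => /and3P[yu yv _].
by rewrite index_cat (negPf yu) /= (negPf xy) index_cat (negPf yv) /= eqxx addn0.
Qed.

Lemma smooth_index s : s \in w0 ->
  between (index x w, index y w) (index s w) = (s \in v).
Proof.
move/index_w; rewrite /between /= index_x index_y.
by case: (s \in v); rewrite /= ?andbF ?orbF ?andbT; lia.
Qed.

(** [smooth_lt] is the order of the word [w0] obtained by smoothing [w]. *)
Lemma smooth_lt_index s t : s \in w0 -> t \in w0 ->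
  (index s w0 < index t w0)%N =
  smooth_lt (index x w, index y w) (index s w) (index t w).
Proof.
move=> sw tw; rewrite /smooth_lt !smooth_index //.
move: (index_w sw) (index_w tw).
case: (s \in v); case: (t \in v); rewrite /= ?andbF ?orbF ?andbT; lia.
Qed.
End Word.

Lemma first_split (T : Type) (p : pred T) (s : seq T) : has p s ->
  exists u x r, [/\ s = u ++ x :: r, p x, ~~ has p u, find p s = size u &
                    take (find p s) s = u /\ drop (find p s).+1 s = r].
Proof.
move=> hs; have x0 : T by case: s hs.
case: (split_find_nth x0 hs) => x u r px nu.
have E : find p (rcons u x ++ r) = size u.
  by rewrite cat_rcons find_cat (negPf nu) /= px addn0.
by exists u, x, r; rewrite E; split; rewrite ?cat_rcons //.
Qed.

(** Up to reversal, the smoothed word is obtained by reversing the part between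
    the two passages of [c], whichever of them is the over-passage. *)
Lemma smooth_word D c : matched (word D) -> c \in crossings D ->
  exists u x v y z,
    [/\ word D = u ++ x :: v ++ y :: z, name x = c, name y = c,
        filter (fun t => name t != c) (word D) = u ++ v ++ z &
        exists b : bool, word (smooth D c) = map (flip_ends v)
          (if b then rev (u ++ rev v ++ z) else u ++ rev v ++ z)].
Proof.
move=> wm cC; have [t [tw _ tc _]] := crossingP true wm cC.
have [_ /allP/(_ t tw)/andP[_]] := andP wm; rewrite tc.
rewrite /smooth; set at_c := fun _ => name _ == c => /eqP count2.
have hasw : has at_c (word D) by rewrite has_count count2.
have [u [x [r [wE xc uc _ [-> ->]]]]] := first_split hasw.
have hasr : has at_c r.
  move: count2; rewrite wE count_cat /= xc has_count.
  by move: uc; rewrite has_count -eqn0Ngt => /eqP->; case: (count _ r).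
have [v [y [z [rE yc vc _ [-> ->]]]]] := first_split hasr.
have zc : ~~ has at_c z.
  move: count2; rewrite wE rE !count_cat /= count_cat /= xc yc has_count.
  by lia.
exists u, x, v, y, z; split.
- by rewrite wE rE.
- exact/eqP.
- exact/eqP.
- have keep s : ~~ has at_c s -> [seq t <- s | name t != c] = s.
    by rewrite -all_predC => /all_filterP.
  by rewrite wE rE filter_cat /= filter_cat /= (eqP xc) (eqP yc) eqxx /= !keep.
case: ifP => _ /=; last by exists false.
by exists true; rewrite !rev_cat revK -catA.
Qed.

Lemma crossings_perm D D' : perm_eq (word D) (word D') ->
  perm_eq (crossings D) (crossings D').
Proof. by move=> DD'; rewrite perm_map // perm_filter. Qed.

Lemma between_swap c p : between (swap c) p = between c p.
Proof. by rewrite /between /= addbC. Qed.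

Lemma smooth_lt_swap c p q : smooth_lt (swap c) p q = smooth_lt c p q.
Proof. by rewrite /smooth_lt !between_swap. Qed.

Lemma count_name w v t : matched w -> uniq v -> {subset v <= w} -> t \in w ->
  count (fun t' => name t' == name t) v = ((t \in v) + (mate t \in v))%N.
Proof.
move=> wm uv vw tw; rewrite -!(count_uniq_mem _ uv) -count_predUI.
rewrite [X in (_ + X)%N](@eq_count _ _ pred0) ?count_pred0 ?addn0 => [|s /=].
  apply: eq_in_count => s /vw sw /=; apply/eqP/orP => [st | [/eqP->|/eqP->]] //.
  by case: (matched_name wm sw tw st) => ->; rewrite eqxx; auto.
by case: eqP => //= ->; rewrite eq_sym (negPf (mate_neq t)).
Qed.

Lemma dwrithe_smooth n D c : matched (word D) -> c \in crossings D ->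
  `|dwrithe n (smooth D c)|%N =
  `|dwrithe_of n (rem c (crossings D)) (smooth_matrix (pos D) c)|%N.
Proof.
move=> wm cC; have [u [x [v [y [z [wE xc yc w0E [b DE]]]]]]] := smooth_word wm cC.
set w0 := u ++ rev v ++ z in DE; pose f := flip_ends v.
have fI : injective f := can_inj (flipK v).
have w0p : perm_eq (u ++ v ++ z) w0.
  by rewrite perm_cat2l perm_cat2r perm_sym perm_rev.
have w0'p : perm_eq w0 (if b then rev w0 else w0).
  by case: b {DE} => //; rewrite perm_sym perm_rev.
have w0m : matched (if b then rev w0 else w0).
  apply: (matched_perm w0'p); apply: (matched_perm w0p); rewrite -w0E.
  by apply: matched_filter => // s t _ _ ->.
have Dm : matched (word (smooth D c)).
  rewrite DE; apply: matched_map => // t; [exact: name_flip | exact: mate_flip].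
have uw : uniq (u ++ x :: v ++ y :: z) by rewrite -wE matched_uniq.
have w0w t : (t \in w0) = (t \in word D) && (name t != c).
  by rewrite -(perm_mem w0p) -w0E mem_filter andbC.
have Cp : perm_eq (crossings (smooth D c)) (rem c (crossings D)).
  rewrite (rem_filter _ (uniq_crossings wm)) /crossings DE !filter_map -map_comp.
  rewrite (eq_map (_ : name \o flip_ends v =1 name)); last exact: name_flip.
  rewrite (eq_filter (_ : preim (flip_ends v) over =1 over)); last first.
    by move=> t; rewrite /= /Defs.over kind_flip.
  apply: perm_map; rewrite perm_sym -filter_predI.
  rewrite (eq_filter (_ : _ =1 predI over (fun t => name t != c))); last first.
    by move=> t; rewrite /= andbC.
  by rewrite filter_predI w0E perm_filter // (perm_trans w0p).
rewrite dwrithe_crossings // (dwrithe_of_perm _ _ Cp).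
have ox : chord (pos D) c = (index x (word D), index y (word D)) \/
          chord (pos D) c = swap (index x (word D), index y (word D)).
  have [xw yw] : x \in word D /\ y \in word D.
    by rewrite wE !(mem_cat, in_cons) !eqxx !orbT.
  have yx : y = mate x.
    case: (matched_name wm yw xw) => [|E|//]; first by rewrite yc.
    by move: uw; rewrite E -cat_rcons cat_uniq rcons_uniq => /and3P[_ + _];
       rewrite /= has_cat /= mem_rcons mem_head orbT.
  have := pos_index wm xw; have := pos_index wm yw.
  rewrite yc xc yx /chord /=; case: (lr x) => /= -> ->; first by left.
  by right.
have betE t : t \in w0 -> between (chord (pos D) c) (index t (word D)) = (t \in v).
  by move=> tw0; case: ox => ->; rewrite ?between_swap wE smooth_index.
have ltE s t : s \in w0 -> t \in w0 ->
    smooth_lt (chord (pos D) c) (index s (word D)) (index t (word D)) =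
    (index s w0 < index t w0)%N.
  by move=> sw0 tw0; case: ox => ->; rewrite ?smooth_lt_swap wE -smooth_lt_index.
(* [s] is the passage of [e] that comes from bottom left after smoothing. *)
have chordE e : e \in rem c (crossings D) -> exists s, [/\ s \in w0, mate s \in w0,
    name s = e,
    chord (pos (smooth D c)) e = (index (f s) (word (smooth D c)),
                                  index (f (mate s)) (word (smooth D c))) &
    smooth_chord (chord (pos D) c) (chord (pos D) e) =
      (index s (word D), index (mate s) (word D))].
  rewrite mem_rem_uniq ?uniq_crossings // => /andP[/= ec eC].
  have [t [tw tcl te tT]] := crossingP true wm eC.
  have mtw : mate t \in word D by rewrite matched_mate.
  have t0 : t \in w0 by rewrite w0w tw te.
  have mt0 : mate t \in w0 by rewrite w0w mtw /= te.
  have fw s : s \in w0 -> f s \in word (smooth D c).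
    by move=> s0; rewrite DE map_f // -(perm_mem w0'p).
  have pt := pos_index wm tw; have pm := pos_index wm mtw.
  have pft := pos_index Dm (fw _ t0); have pfm := pos_index Dm (fw _ mt0).
  move: pt pm pft pfm; rewrite !name_flip /= te tT /= => pt pm.
  have cE s : s \in word D ->
      count (fun t' => name t' == name s) v = ((s \in v) + (mate s \in v))%N.
    apply: (count_name wm).
      by move: uw; rewrite cat_uniq /= cat_uniq => /and5P[_ _ _ ->].
    by move=> r rv; rewrite wE !(mem_cat, in_cons) rv !orbT.
  have lrf s : s \in word D ->
      lr (f s) = lr s (+) ((s \in v) (+) (mate s \in v)).
    move=> sw; rewrite /f /flip_ends cE //.
    by do 2 case: (_ \in v); case: (s) => ? ? [].
  have chE : smooth_chord (chord (pos D) c) (chord (pos D) e) =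
      if (t \in v) (+) (mate t \in v) then (index (mate t) (word D), index t (word D))
      else (index t (word D), index (mate t) (word D)).
    by rewrite /smooth_chord /swap /chord /= pt pm -/(chord _ _) !betE.
  rewrite chE !lrf // mateK /= tT /= (addbC (mate t \in v)) {chE}/chord.
  case: (_ (+) _) => /= -> ->.
    by exists (mate t); rewrite mateK.
  by exists t.
have lt_w0 s t : s \in w0 -> t \in w0 ->
    (index (f s) (word (smooth D c)) < index (f t) (word (smooth D c)))%N =
    if b then smooth_lt (chord (pos D) c) (index t (word D)) (index s (word D))
    else smooth_lt (chord (pos D) c) (index s (word D)) (index t (word D)).
  move=> s0 t0; rewrite DE !index_map // !ltE //.
  case: (b) => //; rewrite index_rev_lt //.
  by rewrite -(perm_uniq w0p) -w0E filter_uniq ?matched_uniq.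
have smE e d : e \in rem c (crossings D) -> d \in rem c (crossings D) ->
    index_matrix (pos (smooth D c)) e d =
    if b then - smooth_matrix (pos D) c e d else smooth_matrix (pos D) c e d.
  move=> eC dC; rewrite /index_matrix /smooth_matrix.
  case: eqVneq => [|ed]; first by rewrite oppr0; case: (b).
  have [s [s0 ms0 se -> sE]] := chordE e eC.
  have [t [t0 mt0 td -> tE]] := chordE d dC.
  rewrite /smooth_linking sE tE /linking /= !lt_w0 //.
  case: (b) => //; rewrite !ltE //.
  have ltC p q : p \in w0 -> q \in w0 -> p != q ->
      (index p w0 < index q w0)%N%:Z = 1 - (index q w0 < index p w0)%N%:Z.
    by move=> p0 q0 pq; case: ltngtP => // /index_inj E; rewrite E ?eqxx in pq.
  have ne p q : name p = e -> name q = d -> p != q.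
    by move=> pe qd; apply: contraNneq ed => pq; rewrite -pe -qd pq.
  rewrite (ltC s t) ?ne // (ltC s (mate t)) ?ne // (ltC (mate s) t) ?ne //.
  by rewrite (ltC (mate s) (mate t)) ?ne //; ring.
case: (b) smE => smE; last by congr absz; apply: dwrithe_of_ext.
by rewrite -[in RHS]abszN; congr absz; apply: dwrithe_ofN.
Qed.

(** * Invariance under the moves *)
Lemma Lpoly_gauss n D : matched (word D) ->
  Lpoly n D = gauss_poly n (crossings D) (sgn D) (pos D).
Proof.
move=> wm; apply: eq_big_seq => c cC.
by rewrite /gauss_term -Ind_crossings // dwrithe_smooth // dwrithe_crossings.
Qed.

Lemma index_filter_lt (T : eqType) (p : pred T) (w : seq T) s t :
  p s -> p t ->
  (index s (filter p w) < index t (filter p w))%N = (index s w < index t w)%N.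
Proof.
move=> ps pt; elim: w => //= x w IHw; have [px | npx] := boolP (p x).
  by rewrite /=; do 2 case: (x == _) => //.
have [sx tx] : (x == s) = false /\ (x == t) = false.
  by split; apply: contraNF npx => /eqP->.
by rewrite sx tx.
Qed.

(** Deleting double points keeps the signs and the order of the other ones. *)
Lemma gauss_poly_filter n D D' (p : pred passage) : matched (word D) ->
  word D' = filter p (word D) ->
  {in word D &, forall s t, name s = name t -> p s = p t} ->
  gauss_poly n (crossings D') (sgn D) (pos D) =
  gauss_poly n (crossings D') (sgn D') (pos D').
Proof.
move=> wm D'E pn.
have wm' : matched (word D') by rewrite D'E; apply: matched_filter.
apply: gauss_poly_same_order; first exact: uniq_crossings.
  move=> c cC; have [t [+ _ tc _]] := crossingP true wm' cC.
  rewrite /sgn D'E !mem_filter => /andP[pt tw].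
  by case: (boolP (_ \in word D)) => [ow | _]; rewrite ?andbF // (pn _ t) ?pt.
move=> e d eC dC b b' _.
have [s [sw _ <- <-]] := crossingP b wm' eC.
have [t [tw _ <- <-]] := crossingP b' wm' dC.
rewrite (pos_index wm' sw) (pos_index wm' tw).
move: sw tw; rewrite D'E !mem_filter => /andP[ps sw] /andP[pt tw].
by rewrite (pos_index wm sw) (pos_index wm tw) index_filter_lt.
Qed.

Lemma Lpoly_classical n D D' : matched (word D) -> matched (word D') ->
  filter classical (word D) = filter classical (word D') ->
  Lpoly n D = Lpoly n D'.
Proof.
move=> wm wm' E; rewrite !Lpoly_gauss //.
have cn w : matched w ->
    {in w &, forall s t, name s = name t -> classical s = classical t}.
  by move=> m s t sw tw /(matched_name m sw tw)[] ->; rewrite ?classical_mate.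
have crE F : crossings F = crossings (Code true (filter classical (word F))).
  rewrite /crossings -filter_predI; congr map; apply: eq_filter => v /=.
  by case: (boolP (over v)) => // /over_classical ->.
pose F := Code true (filter classical (word D)).
have FE : word F = filter classical (word D') := E.
rewrite (crE D) (crE D') -E -/F.
by rewrite (gauss_poly_filter n wm (erefl (word F)) (cn _ wm))
  (gauss_poly_filter n wm' FE (cn _ wm')).
Qed.

(** The names of the crossings created by a move are new. *)
Lemma matched_fresh w x r : matched w -> perm_eq w (x :: mate x :: r) ->
  {in r, forall t, name t != name x}.
Proof.
move=> wm wr t tr; have := matched_uniq wm.
rewrite (perm_uniq wr) /= in_cons negb_or => /and3P[/andP[_ xr] mr _].
apply/eqP => tx; have [||E|E] := matched_name wm _ _ tx.
- by rewrite (perm_mem wr) !in_cons tr !orbT.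
- by rewrite (perm_mem wr) mem_head.
- by rewrite -E tr in xr.
- by rewrite -E tr in mr.
Qed.

Lemma crossings_cons s x w : classical x ->
  crossings (Code s (x :: mate x :: w)) = name x :: crossings (Code s w).
Proof. by case: x => c [] b. Qed.

Lemma index_mid (T : eqType) (w1 s w2 : seq T) v : uniq (w1 ++ s ++ w2) ->
  v \in s -> index v (w1 ++ s ++ w2) = (size w1 + index v s)%N.
Proof.
rewrite cat_uniq => /and3P[_ + _] vs; rewrite index_cat index_cat vs.
by case: ifP => // vw1 /hasPn/(_ v); rewrite mem_cat vs /= vw1 => /(_ isT).
Qed.

Lemma distinct_neq C P e d b b' : distinct_ends C P -> e \in C -> d \in C ->
  e != d -> P e b != P d b'.
Proof. by move=> inj eC dC; apply: contraNneq => /(inj e d eC dC)[-> _]. Qed.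

Lemma index_rot1 (T : eqType) (w : seq T) t : uniq w -> t \in w ->
  (index t (rot 1 w)).+1 = shift0 (size w) (index t w).
Proof.
case: w => // x w /= /andP[xw _].
rewrite in_cons rot1_cons -cats1 index_cat /shift0 /= eq_sym.
case: eqVneq => [<- _|tx /= tw].
  by rewrite (negPf xw) ?eqxx addn0.
by rewrite tw.
Qed.

Lemma Lpoly_rot1 n s s' w : matched w ->
  Lpoly n (Code s (rot 1 w)) = Lpoly n (Code s' w).
Proof.
move=> wm; have rm : matched (rot 1 w).
  by apply: matched_perm wm; rewrite perm_sym perm_rot.
set D := Code s _; set D' := Code s' w.
have CD : perm_eq (crossings D) (crossings D').
  by apply: crossings_perm; rewrite /= perm_rot.
rewrite !Lpoly_gauss // (gauss_poly_perm _ _ _ CD).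
have uC := uniq_crossings (D := D') wm; have inj := pos_distinct (D := D') wm.
rewrite -(gauss_poly_rot (N := size w) n _ uC inj) => [|c cC b]; last first.
  exact: (pos_lt_size (D := D')).
apply: gauss_poly_same_order => // [c _|]; first by rewrite /sgn /= mem_rot.
(* The passage moved to the end has position [size w - 1]; hence the shift. *)
have key e b : e \in crossings D' -> (pos D e b).+1 = shift0 (size w) (pos D' e b).
  move=> eC; have [t [tw _ <- <-]] := crossingP (D := D') b wm eC.
  rewrite !pos_index //= ?mem_rot //.
  by rewrite index_rot1 ?matched_uniq.
by move=> e d eC dC b b' _; rewrite -!key.
Qed.

Lemma Lpoly_rot n s s' w i : matched w -> (i <= size w)%N ->
  Lpoly n (Code s (rot i w)) = Lpoly n (Code s' w).
Proof.
move=> wm; elim: i s => [|i IHi] s iw; first by rewrite rot0 !Lpoly_gauss.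
rewrite rotS // (Lpoly_rot1 n s s) ?IHi ?(ltnW iw) //.
by apply: matched_perm wm; rewrite perm_sym perm_rot.
Qed.

Lemma gauss_poly_map n f C sg P : injective f ->
  gauss_poly n (map f C) sg P =
  gauss_poly n C (sg \o f) (fun c => P (f c)).
Proof.
move=> fI; rewrite /gauss_poly big_map; apply: eq_bigr => c _.
have W S M M' : (forall e d, M (f e) (f d) = M' e d) ->
    dwrithe_of n (map f S) M = dwrithe_of n S M'.
  move=> MM'; rewrite /dwrithe_of big_map; apply: eq_bigr => e _.
  by rewrite big_map; congr weight; apply: eq_bigr.
have rE : rem (f c) (map f C) = map f (rem c C).
  by elim: C => //= x C ->; rewrite (inj_eq fI); case: ifP.
rewrite /gauss_term rE big_map; congr (_ * (_ ^ (_ * _) * _ ^+ `|_|%N - _ ^+ `|_|%N)).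
- by apply: eq_bigr => d _; rewrite /index_matrix (inj_eq fI).
- by apply: W => e d; rewrite /smooth_matrix (inj_eq fI).
- by apply: W => e d; rewrite /index_matrix (inj_eq fI).
Qed.

Lemma Lpoly_rename n f s w : injective f -> matched w -> matched (map (rename f) w) ->
  Lpoly n (Code s (map (rename f) w)) = Lpoly n (Code s w).
Proof.
move=> fI wm wm'; rewrite !Lpoly_gauss //.
have rI : injective (rename f) by move=> [c k b] [c' k' b'] [/fI-> -> ->].
have -> : crossings (Code s (map (rename f) w)) = map f (crossings (Code s w)).
  by rewrite /crossings filter_map -!map_comp.
rewrite gauss_poly_map //; apply: gauss_poly_same_order.
- exact: uniq_crossings.
- move=> c _; rewrite /sgn /= -[Passage (f c) Over true]/(rename f (Passage c Over true)).
  by rewrite mem_map.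
move=> e d _ _ b b' _; rewrite /pos /= !find_map.
by congr (_ < _)%N; apply: eq_find => v /=; rewrite (inj_eq fI).
Qed.

Lemma filter_name_out (x : passage) (s : seq passage) :
  {in s, forall t, name t != name x} -> filter (fun t => name t != name x) s = s.
Proof. by move=> sx; apply/all_filterP/allP. Qed.

Lemma Lpoly_RI n s w1 w2 x : classical x ->
  matched (w1 ++ [:: x; mate x] ++ w2) ->
  Lpoly n (Code s (w1 ++ w2)) = Lpoly n (Code s (w1 ++ [:: x; mate x] ++ w2)).
Proof.
move=> cx wm'; set D' := Code s (_ ++ _ ++ _).
have wp : perm_eq (word D') (x :: mate x :: w1 ++ w2).
  exact: permEl (perm_catCA w1 [:: x; mate x] w2).
have fr := matched_fresh wm' wp.
have fE : w1 ++ w2 = filter (fun t => name t != name x) (word D').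
  have := filter_name_out fr; rewrite /D' /= !filter_cat /= eqxx /= => ->.
  by [].
have wm : matched (w1 ++ w2) by rewrite fE; apply: matched_filter => // u v _ _ ->.
have Cp : perm_eq (crossings D') (name x :: crossings (Code s (w1 ++ w2))).
  rewrite -crossings_cons //; exact: (@crossings_perm D' (Code s _) wp).
rewrite !Lpoly_gauss // (gauss_poly_perm _ _ _ Cp).
have inj : distinct_ends (name x :: crossings (Code s (w1 ++ w2))) (pos D').
  move=> e d; rewrite -!(perm_mem Cp); exact: (pos_distinct (D := D')).
have uC : uniq (name x :: crossings (Code s (w1 ++ w2))).
  by rewrite -(perm_uniq Cp) (uniq_crossings (D := D')).
have [xw mw] : x \in word D' /\ mate x \in word D'.
  by rewrite !(perm_mem wp) !in_cons !eqxx orbT.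
have px : pos D' (name x) (lr x) = size w1.
  rewrite (pos_index (D := D')) // index_mid ?matched_uniq ?mem_head //=.
  by rewrite eqxx addn0.
have pm : pos D' (name x) (~~ lr x) = (size w1).+1.
  rewrite -[LHS]/(pos D' (name (mate x)) (lr (mate x))) (pos_index (D := D')) //.
  rewrite index_mid ?matched_uniq ?inE ?eqxx ?orbT //=.
  by rewrite eq_sym (negPf (mate_neq x)) eqxx addn1.
rewrite gauss_poly_R1 //; last first.
  move=> e eC b b'.
  have ex : e != name x by apply: contraTneq uC => <-; rewrite /= eC.
  have eC' : e \in name x :: crossings (Code s (w1 ++ w2)) by rewrite in_cons eC orbT.
  have n1 := distinct_neq b (lr x) inj eC' (mem_head _ _) ex.
  have n2 := distinct_neq b (~~ lr x) inj eC' (mem_head _ _) ex.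
  move: n1 n2; have [->|->] : b' = lr x \/ b' = ~~ lr x.
  - by case: (b') (lr x) => [] []; auto.
  - by rewrite px pm; clear; lia.
  - by rewrite negbK px pm; clear; lia.
symmetry; apply: (@gauss_poly_filter n D' (Code s _) (fun t => name t != name x)) => //.
by move=> u v _ _ ->.
Qed.

Lemma mem_two o (u v : passage) : two o u v =i [:: u; v].
Proof. by case: o => // t; rewrite !inE orbC. Qed.

Lemma size_two o u v : size (two o u v) = 2.
Proof. by case: o. Qed.

Lemma index_two o u v : u != v ->
  index u (two o u v) = ~~ o /\ index v (two o u v) = o.
Proof. by move=> /negPf uv; case: o; rewrite /= ?(eq_sym v) uv !eqxx. Qed.

Lemma perm_two o (u v : passage) : perm_eq (two o u v) [:: u; v].
Proof. by case: o => //; rewrite (perm_catC [:: v] [:: u]). Qed.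

Lemma Lpoly_RII n s w1 w2 w3 x y o :
  classical x -> kind x = kind y -> lr x != lr y ->
  matched (w1 ++ [:: x; y] ++ w2 ++ two o (mate x) (mate y) ++ w3) ->
  Lpoly n (Code s (w1 ++ w2 ++ w3)) =
  Lpoly n (Code s (w1 ++ [:: x; y] ++ w2 ++ two o (mate x) (mate y) ++ w3)).
Proof.
move=> cx kxy lxy wm'; set D' := Code s (_ ++ [:: x; y] ++ _).
have cy : classical y by rewrite /classical -kxy.
have wp : perm_eq (word D') (x :: mate x :: y :: mate y :: w1 ++ w2 ++ w3).
  apply/permP => a; have /permP/(_ a) := perm_two o (mate x) (mate y).
  by rewrite /D' /= !count_cat /= !count_cat /= => ->; lia.
have wp' : perm_eq (word D') (y :: mate y :: x :: mate x :: w1 ++ w2 ++ w3).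
  apply: perm_trans wp _.
  by rewrite (perm_catCA [:: x; mate x] [:: y; mate y] (w1 ++ w2 ++ w3)).
have frx := matched_fresh wm' wp; have fry := matched_fresh wm' wp'.
pose p (t : passage) := (name t != name x) && (name t != name y).
have fE : w1 ++ w2 ++ w3 = filter p (word D').
  have: filter p (w1 ++ w2 ++ w3) = w1 ++ w2 ++ w3.
    apply/all_filterP/allP => t tw; rewrite /p frx ?fry //.
      by rewrite !in_cons tw !orbT.
    by rewrite !in_cons tw !orbT.
  have [px py] : p x = false /\ p y = false by rewrite /p !eqxx andbF.
  have [pmx pmy] : p (mate x) = false /\ p (mate y) = false := conj px py.
  have out2 : filter p (two o (mate x) (mate y)) = [::].
    by case: (o); rewrite /= pmx pmy.
  by rewrite /D' /word !filter_cat out2 /= px py.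
have pn : {in word D' &, forall u v, name u = name v -> p u = p v}.
  by move=> u v _ _; rewrite /p => ->.
have wm : matched (w1 ++ w2 ++ w3) by rewrite fE; apply: matched_filter.
have Cp : perm_eq (crossings D')
    (name x :: name y :: crossings (Code s (w1 ++ w2 ++ w3))).
  rewrite -!(crossings_cons s) //; exact: (@crossings_perm D' (Code s _) wp).
rewrite !Lpoly_gauss // (gauss_poly_perm _ _ _ Cp).
have inj : distinct_ends (name x :: name y :: crossings (Code s (w1 ++ w2 ++ w3)))
    (pos D').
  move=> e d; rewrite -!(perm_mem Cp); exact: (pos_distinct (D := D')).
have uC : uniq (name x :: name y :: crossings (Code s (w1 ++ w2 ++ w3))).
  by rewrite -(perm_uniq Cp) (uniq_crossings (D := D')).
have [xw mxw yw myw] : [/\ x \in word D', mate x \in word D', y \in word D' &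
                           mate y \in word D'].
  by rewrite !(perm_mem wp) !in_cons !eqxx !orbT.
have xy : name x != name y by move: uC; rewrite /= in_cons negb_or => /andP[/andP[]].
have xy' : x != y by apply: contraNneq xy => ->.
have mxy : mate x != mate y by apply: contraNneq xy => /(can_inj mateK)->.
have lyE : lr y = ~~ lr x by case: (lr x) (lr y) lxy => [] [].
have uw := matched_uniq wm'.
have px : pos D' (name x) (lr x) = size w1.
  rewrite (pos_index (D := D')) // index_mid ?mem_head //=.
  by rewrite eqxx addn0.
have py : pos D' (name y) (~~ lr x) = (size w1).+1.
  rewrite -lyE (pos_index (D := D')) // index_mid ?inE ?eqxx ?orbT //=.
  by rewrite (negPf xy') eqxx addn1.
pose m := size (w1 ++ [:: x; y] ++ w2).
have wE : word D' = (w1 ++ [:: x; y] ++ w2) ++ two o (mate x) (mate y) ++ w3.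
  by rewrite /D' /= -!catA.
have uw' := uw; rewrite -[w1 ++ _]/(word D') wE in uw'.
have [imx imy] := index_two o mxy.
have pmx : pos D' (name x) (~~ lr x) = (m + ~~ o)%N.
  rewrite -[LHS]/(pos D' (name (mate x)) (lr (mate x))) (pos_index (D := D')) //.
  by rewrite wE index_mid ?mem_two ?mem_head // imx.
have pmy : pos D' (name y) (lr x) = (m + o)%N.
  rewrite (_ : lr x = lr (mate y)); last by rewrite /= lyE negbK.
  rewrite -[name y]/(name (mate y)) (pos_index (D := D')) //.
  by rewrite wE index_mid ?mem_two ?inE ?eqxx ?orbT // imy.
have km : ((size w1).+1 < m)%N by rewrite /m size_cat /= !addnS !ltnS leq_addr.
have sxy : sgn D' (name x) = - sgn D' (name y).
  rewrite !(sgnE (D := D')) // lyE /Defs.over kxy.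
  by case: (kind y == _); case: (lr x); rewrite /= ?opprK.
rewrite (gauss_poly_R2 n uC inj px py pmx pmy km sxy).
by symmetry; apply: (@gauss_poly_filter n D' (Code s _) p).
Qed.

Lemma Lpoly_RIII n s w1 w2 w3 w4 a b c o1 o2 o3 :
  let w p1 p2 p3 := w1 ++ two p1 a b ++ w2 ++ two p2 (mate a) c ++ w3 ++
                    two p3 (mate b) (mate c) ++ w4 in
  triangle a b c o1 o2 o3 -> [&& classical a, classical b & classical c] ->
  matched (w o1 o2 o3) -> matched (w (~~ o1) (~~ o2) (~~ o3)) ->
  Lpoly n (Code s (w o1 o2 o3)) = Lpoly n (Code s (w (~~ o1) (~~ o2) (~~ o3))).
Proof.
move=> w tri /and3P[ca cb cc] wm wm'.
pose r := w1 ++ w2 ++ w3 ++ w4.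
have wp p1 p2 p3 :
    perm_eq (w p1 p2 p3) [:: a, mate a, b, mate b, c, mate c & r].
  apply/permP => q; have /permP/(_ q) E1 := perm_two p1 a b.
  have /permP/(_ q) E2 := perm_two p2 (mate a) c.
  have /permP/(_ q) E3 := perm_two p3 (mate b) (mate c).
  by rewrite /w /r /= !count_cat E1 E2 E3 /=; clear; lia.
set D := Code s _; set D' := Code s (w (~~ o1) _ _).
have Cp p1 p2 p3 : perm_eq (crossings (Code s (w p1 p2 p3)))
    [:: name a, name b, name c & crossings (Code s r)].
  by rewrite -!(crossings_cons s) //; apply: crossings_perm; apply: wp.
rewrite !Lpoly_gauss // (gauss_poly_perm _ _ _ (Cp o1 o2 o3)).
rewrite (gauss_poly_perm _ _ _ (Cp (~~ o1) (~~ o2) (~~ o3))).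
have uC : uniq [:: name a, name b, name c & crossings (Code s r)].
  by rewrite -(perm_uniq (Cp o1 o2 o3)) (uniq_crossings (D := D)).
have inj : distinct_ends [:: name a, name b, name c & crossings (Code s r)] (pos D).
  move=> e d; rewrite -!(perm_mem (Cp o1 o2 o3)); exact: (pos_distinct (D := D)).
have sgE : sgn D' =1 sgn D.
  by move=> e; rewrite /sgn /= !(perm_mem (wp _ _ _)).
transitivity (gauss_poly n [:: name a, name b, name c & crossings (Code s r)]
                (sgn D) (pos D')); last first.
  by apply: gauss_poly_same_order.
have nu p1 p2 p3 : matched (w p1 p2 p3) -> uniq [:: a, mate a, b, mate b, c, mate c & r].
  by move=> /matched_uniq; rewrite (perm_uniq (wp _ _ _)).
have [ab mac mbc] : [/\ a != b, mate a != c & mate b != mate c].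
  have := nu _ _ _ wm; rewrite /= !in_cons !negb_or.
  case/and5P=> /and3P[_ -> _] /and4P[_ _ -> _] _ /and3P[_ -> _] _.
  by [].
have rC t : t \in r -> [/\ t \notin [:: a; b], t \notin [:: mate a; c] &
                           t \notin [:: mate b; mate c]].
  move=> tr; have := nu _ _ _ wm.
  rewrite -[_ :: _]/([:: a; mate a; b; mate b; c; mate c] ++ r) cat_uniq.
  case/and3P=> _ /hasPn/(_ t tr) + _; rewrite /= !inE !negb_or.
  by case/and5P=> -> -> -> -> /andP[-> ->].
(* [~~ p1] and [p1] give the places, 0 or 1, of [a] and [b] on their strand. *)
have loc p1 p2 p3 : matched (w p1 p2 p3) ->
  let P := pos (Code s (w p1 p2 p3)) in
  let n1 := size w1 in let n2 := size (w1 ++ two o1 a b ++ w2) in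
  let n3 := size (w1 ++ two o1 a b ++ w2 ++ two o2 (mate a) c ++ w3) in
  [/\ P (name a) (lr a) = (n1 + ~~ p1)%N, P (name b) (lr b) = (n1 + p1)%N,
      P (name a) (~~ lr a) = (n2 + ~~ p2)%N & P (name c) (lr c) = (n2 + p2)%N] /\
  (P (name b) (~~ lr b) = (n3 + ~~ p3)%N /\ P (name c) (~~ lr c) = (n3 + p3)%N).
  move=> m P n1 n2 n3; have um := matched_uniq m.
  have inw t : t \in [:: a; mate a; b; mate b; c; mate c] -> t \in w p1 p2 p3.
    move=> tin; rewrite (perm_mem (wp _ _ _)).
    rewrite -[_ :: _]/([:: a; mate a; b; mate b; c; mate c] ++ r).
    by rewrite mem_cat tin.
  have PE t : t \in [:: a; mate a; b; mate b; c; mate c] ->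
      P (name t) (lr t) = index t (w p1 p2 p3).
    by move=> /inw; apply: (@pos_index (Code s (w p1 p2 p3)) t m).
  have w2E : w p1 p2 p3 = (w1 ++ two p1 a b ++ w2) ++ two p2 (mate a) c ++
      (w3 ++ two p3 (mate b) (mate c) ++ w4) by rewrite /w -!catA.
  have w3E : w p1 p2 p3 = (w1 ++ two p1 a b ++ w2 ++ two p2 (mate a) c ++ w3) ++
      two p3 (mate b) (mate c) ++ w4 by rewrite /w -!catA.
  have [ia ib] := index_two p1 ab; have [ima ic] := index_two p2 mac.
  have [imb imc] := index_two p3 mbc.
  have n2E : n2 = size (w1 ++ two p1 a b ++ w2) by rewrite /n2 !size_cat !size_two.
  have n3E : n3 = size (w1 ++ two p1 a b ++ w2 ++ two p2 (mate a) c ++ w3).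
    by rewrite /n3 !size_cat !size_two.
  have l1 t : t \in [:: a; b] -> index t (w p1 p2 p3) = (n1 + index t (two p1 a b))%N.
    by move=> tin; rewrite /w index_mid ?mem_two.
  have l2 t : t \in [:: mate a; c] ->
      index t (w p1 p2 p3) = (n2 + index t (two p2 (mate a) c))%N.
    by move=> tin; rewrite n2E w2E index_mid ?mem_two // -w2E.
  have l3 t : t \in [:: mate b; mate c] ->
      index t (w p1 p2 p3) = (n3 + index t (two p3 (mate b) (mate c)))%N.
    by move=> tin; rewrite n3E w3E index_mid ?mem_two // -w3E.
  split; first split.
  - by rewrite PE ?l1 ?ia ?inE ?eqxx ?orbT.
  - by rewrite PE ?l1 ?ib ?inE ?eqxx ?orbT.
  - by have := PE (mate a); rewrite /= => ->; rewrite ?l2 ?ima ?inE ?eqxx ?orbT.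
  - by rewrite PE ?l2 ?ic ?inE ?eqxx ?orbT.
  split.
  - by have := PE (mate b); rewrite /= => ->; rewrite ?l3 ?imb ?inE ?eqxx ?orbT.
  - by have := PE (mate c); rewrite /= => ->; rewrite ?l3 ?imc ?inE ?eqxx ?orbT.
have [[a1 b1 a2 c2] [b3 c3]] := loc _ _ _ wm.
have [[a1' b1' a2' c2'] [b3' c3']] := loc _ _ _ wm'.
rewrite !negbK in a1' a2' b3'.
apply: (gauss_poly_R3 n (sgn D) uC inj _ a1 b1 a2 c2 b3 c3 a1' b1' a2' c2' b3' c3').
- move=> e eC x.
  have eC' : e \in crossings D.
    by rewrite (perm_mem (Cp o1 o2 o3)) !in_cons eC !orbT.
  have [t [tD _ te <-]] := crossingP (D := D) x wm eC'.
  have tr : t \in r.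
    apply: contraT => ntr; move: tD.
    rewrite (perm_mem (wp o1 o2 o3)).
    rewrite -[_ :: _]/([:: a; mate a; b; mate b; c; mate c] ++ r).
    rewrite mem_cat (negPf ntr) orbF => t6.
    have : uniq ([:: name a; name b; name c] ++ crossings (Code s r)) := uC.
    rewrite cat_uniq => /and3P[_ /hasPn/(_ e eC) + _].
    have /allP/(_ t t6) : all (fun u => name u \in [:: name a; name b; name c])
                              [:: a; mate a; b; mate b; c; mate c].
      by rewrite /= !inE !eqxx !orbT.
    by rewrite te => ->.
  rewrite -te.
  have [t1 t2 t3] := rC t tr.
  have tw p1 p2 p3 : t \in w p1 p2 p3.
    by rewrite (perm_mem (wp _ _ _)) !in_cons [t \in r]tr !orbT.
  rewrite (pos_index (D := D)) ?(pos_index (D := D')) //= ?tw // /w.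
  by rewrite !index_cat !mem_two (negPf t1) (negPf t2) (negPf t3) !size_two.
- by rewrite !size_cat size_two addnCA !ltnS leq_addr.
- by rewrite !size_cat !size_two; clear; lia.
exact: tri.
Qed.

Lemma filter_two o u v : ~~ (classical u && classical v) ->
  filter classical (two o u v) = filter classical (two (~~ o) u v).
Proof. by case: o => /=; case: (classical u); case: (classical v). Qed.

Lemma Lpoly_step n (D D' : diagram) : step D D' -> Lpoly n D = Lpoly n D'.
Proof.
case: D D' => [D Dm Dp] [D' Dm' Dp'] /= st; move: Dm Dm'; clear Dp Dp'.
case: st => [f s w fI|s s' w i j _|s w1 w2 x cx|s w1 w2 x vx|
             s w1 w2 w3 x y o cx kxy lxy|s w1 w2 w3 x y o vx vy lxy|
             s w1 w2 w3 w4 a b c o1 o2 o3 tri type] wm wm'.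
- by rewrite Lpoly_rename.
- have m : matched w by apply: matched_perm wm; rewrite perm_rot.
  by rewrite !(Lpoly_rot n _ s m) // ltnW.
- exact: Lpoly_RI.
- apply: Lpoly_classical => //; rewrite /word !filter_cat.
  rewrite (_ : filter classical [:: x; mate x] = [::]) //.
  by case: x vx {wm'} => c [].
- exact: Lpoly_RII.
- apply: Lpoly_classical => //; rewrite /word !filter_cat.
  rewrite (_ : filter classical [:: x; y] = [::]); last first.
    by case: x y vx vy {lxy wm'} => [c [] b] [c' [] b'].
  rewrite (_ : filter classical (two o (mate x) (mate y)) = [::]) //.
  by case: o x y vx vy {lxy wm'} => [] [c [] b] [c' [] b'].
case/or3P: type => [t3 | t3 | t3].
- by apply: Lpoly_RIII => //; case/andP: t3.
all: apply: Lpoly_classical => //=; rewrite !filter_cat.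
(* At most one of the three double points is classical. *)
all: have vC v : virtual v = ~~ classical v by rewrite /classical negbK.
all: suff [ab ac bc] : [/\ ~~ (classical a && classical b),
    ~~ (classical (mate a) && classical c) &
    ~~ (classical (mate b) && classical (mate c))]
  by rewrite (filter_two _ ab) (filter_two _ ac) (filter_two _ bc).
all: move: t3; rewrite /VRIII_type /SV_type !classical_mate !vC.
all: by case: (classical a) (classical b) (classical c) => [] [] [].
Qed.

End Invariance.

Theorem theorem3p3 (n : nat) (D D' : diagram) :
  0 < n -> same_virtual_knot D D' -> Lpoly n D = Lpoly n D'.
Proof.
move=> _; elim=> {D D'} [D D' /Lpoly_step-> | D | D D' _ -> | D E D' _ -> _ ->] //.
Qed.
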